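(* Let $K$ be a field, let $Q$ be a finite loop-free quiver, $S$ a potential on $Q$, $k\in Q_0$ a vertex not incident to any $2$-cycle of $Q$, and $\mathcal M=(M,V)$ a decorated $\mathcal P(Q,S)$-module (no finite-dimensionality assumed). Let $(\overline M,\overline V)$, $\eta$, $\theta$, $\widetilde\rho$, $\kappa$, $\psi$ and the $K$-linear maps $\widetilde\eta(u)\in\operatorname{End}_K(\overline M)$ (for $u\in K\langle\langle\widetilde\mu_k(Q)\rangle\rangle$) be as defined in the context. Then: (1) The assignment $u\mapsto\widetilde\eta(u)$ is a $K^{Q_0}$-ring homomorphism $\widetilde\eta:K\langle\langle\widetilde\mu_k(Q)\rangle\rangle\to\operatorname{End}_K(\overline M)$. (2) $\widetilde\eta$ is the unique $K^{Q_0}$-ring homomorphism $K\langle\langle\widetilde\mu_k(Q)\rangle\rangle\to\operatorname{End}_K(\overline M)$ whose restriction to the path algebra $K\langle\widetilde\mu_k(Q)\rangle$ equals $\eta$ and whose restriction to $e_{\widehat k}K\langle\langle\widetilde\mu_k(Q)\rangle\rangle e_{\widehat k}$ equals $\theta\circ\widetilde\rho\circ\psi\circ\kappa$. (3) If $\mathcal M$ is locally nilpotent (resp. nilpotent, resp. finite-dimensional), then so is $(\overline M,\overline V)$.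
   Context: **Quivers and potentials.** $K$ is an arbitrary field; modules are left modules. A quiver $Q=(Q_0,Q_1,h,t)$ is finite and loop-free; an arrow $a$ goes from $t(a)$ to $h(a)$. Paths are composed as functions: $c_1c_2\cdots c_d$ is a path if $t(c_i)=h(c_{i+1})$. $e_j$ is the length-$0$ path at $j$. $K\langle Q\rangle$ is the path algebra, $K\langle\langle Q\rangle\rangle$ the complete path algebra (possibly infinite linear combinations of paths), $\mathfrak m$ its ideal generated by the arrows, with the $\mathfrak m$-adic topology. $K^{Q_0}=\prod_{j\in Q_0}K$ is identified with the span of the $e_j$. A $K^{Q_0}$-ring homomorphism between such algebras is a $K$-algebra homomorphism sending $e_j$ to $e_j$ for all $j$; when the target is $\operatorname{End}_K(N)$ for a $K^{Q_0}$-module $N=\bigoplus_jN_j$, $e_j$ must go to the projection onto $N_j$. A potential $S$ is a possibly infinite linear combination of cyclic paths of positive length; $(Q,S)$ is a QP. For a cyclic path, $\partial_a(c_1\cdots c_d)=\sum_{i:c_i=a}c_{i+1}\cdots c_dc_1\cdots c_{i-1}$, and for arrows $a,b$ with $h(a)=t(b)$, $\partial_{ba}(c_1\cdots c_d)=\sum_{i:\,c_ic_{i+1}=ba}c_{i+2}\cdots c_dc_1\cdots c_{i-1}$ (indices mod $d$); both are extended linearly and continuously. $J(S)$ is the $\mathfrak m$-adic closure of the two-sided ideal generated by all $\partial_a(S)$, and $\mathcal P(Q,S)=K\langle\langle Q\rangle\rangle/J(S)$. A decorated $\mathcal P(Q,S)$-module is a pair $(M,V)$ with $M$ a left $\mathcal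 P(Q,S)$-module and $V$ a left $K^{Q_0}$-module; $M_j=e_jM$, and $u_M$ is the action of $u$ on $M$. It is finite-dimensional if $M$ and $V$ are; it is locally nilpotent if each element of $M$ is annihilated by some power of the arrow ideal, and nilpotent if some power of the arrow ideal annihilates $M$. **Premutated quiver.** $\widetilde\mu_k(Q)$ has vertex set $Q_0$; its arrows are: the arrows of $Q$ not incident to $k$; an arrow $[ba]:t(a)\to h(b)$ for each pair $a,b\in Q_1$ with $h(a)=k=t(b)$; and an arrow $c^*$ opposite to $c$ for each $c\in Q_1$ incident to $k$. **Triangle.** Let $a_1,\dots,a_s$ (resp. $b_1,\dots,b_r$) be the arrows of $Q$ ending (resp. starting) at $k$. Put $M_{\rm in}=\bigoplus_iM_{t(a_i)}$, $M_{\rm out}=\bigoplus_jM_{h(b_j)}$, $\alpha=[(a_1)_M\cdots(a_s)_M]:M_{\rm in}\to M_k$, $\beta=[(b_1)_M\cdots(b_r)_M]^{T}:M_k\to M_{\rm out}$, and $\gamma:M_{\rm out}\to M_{\rm in}$ with $(i,j)$ entry $(\partial_{b_ja_i}(S))_M$. One has $\alpha\gamma=0=\gamma\beta$. Fix a linear retraction $\rho:M_{\rm out}\to\ker\gamma$ of the inclusion and a linear section $\sigma:\ker\alpha/\operatorname{im}\gamma\to\ker\alpha$ of the projection. $\iota$ denotes inclusions into $M_{\rm in}$; $p:M_{\rm out}\to\operatorname{coker}\beta$ is the projection (also its restriction $\ker\gamma\to\ker\gamma/\operatorname{im}\beta$); $\overline\gamma:\operatorname{coker}\beta\to M_{\rm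 in}$ is induced by $\gamma$. **$(\overline M,\overline V)$.** $\overline M_j=M_j$, $\overline V_j=V_j$ for $j\ne k$; $\overline V_k=\ker\beta/(\ker\beta\cap\operatorname{im}\alpha)$; and $\overline M_k$, $\overline\alpha:M_{\rm out}\to\overline M_k$, $\overline\beta:\overline M_k\to M_{\rm in}$ are given by any one of the following (mutually isomorphic) descriptions: (A) $\overline M_k=\frac{\ker\gamma}{\operatorname{im}\beta}\oplus\operatorname{im}\gamma\oplus\frac{\ker\alpha}{\operatorname{im}\gamma}\oplus V_k$, $\overline\alpha=[-p\rho,\,-\gamma,\,0,\,0]^T$, $\overline\beta=[0,\ \iota,\ \iota\sigma,\ 0]$; (B) $\overline M_k=\frac{\ker\gamma}{\operatorname{im}\beta}\oplus\ker\alpha\oplus V_k$, $\overline\alpha=[-p\rho,\,-\gamma,\,0]^T$, $\overline\beta=[0,\ \iota,\ 0]$; (C) $\overline M_k=\operatorname{coker}\beta\oplus\frac{\ker\alpha}{\operatorname{im}\gamma}\oplus V_k$, $\overline\alpha=[-p,\,0,\,0]^T$, $\overline\beta=[\overline\gamma,\ \iota\sigma,\ 0]$. Put $\overline M=\bigoplus_j\overline M_j$, $\overline V=\bigoplus_j\overline V_j$. $\overline M$ is a representation of $\widetilde\mu_k(Q)$: arrows $c$ of $Q$ not incident to $k$ act as $c_M$, $[ba]$ acts as $b_Ma_M$, and $(a_i^* )_{\overline M}:\overline M_k\to M_{t(a_i)}$, $(b_j^* )_{\overline M}:M_{h(b_j)}\to\overline M_k$ are the components of $\overline\beta$ and $\overline\alpha$.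 Let $\eta:K\langle\widetilde\mu_k(Q)\rangle\to\operatorname{End}_K(\overline M)$ be the corresponding action. **$\widetilde\eta$.** Let $e_{\widehat k}=1-e_k$. For a quiver $Q'$ on $Q_0$, $e_{\widehat k}Q'e_{\widehat k}$ is $Q'$ with $k$ and all arrows incident to $k$ deleted. $\kappa:e_{\widehat k}K\langle\langle\widetilde\mu_k(Q)\rangle\rangle e_{\widehat k}\to K\langle\langle e_{\widehat k}\widetilde\mu_k^2(Q)e_{\widehat k}\rangle\rangle$ is the algebra isomorphism replacing each occurrence of a length-$2$ path $a^*b^*$ ($h(a)=k=t(b)$) by the arrow $[a^*b^*]$. $\psi:K\langle\langle e_{\widehat k}\widetilde\mu_k^2(Q)e_{\widehat k}\rangle\rangle\to e_{\widehat k}K\langle\langle Q\rangle\rangle e_{\widehat k}$ is the unique algebra homomorphism fixing each $e_j$ ($j\neq k$) with $\psi(c)=c$ for $c\in Q_1$ not incident to $k$, $\psi([ba])=ba$, $\psi([a^*b^*])=-\partial_{ba}(S)$. $\widetilde\rho:K\langle\langle Q\rangle\rangle\to\operatorname{End}_K(M)$ is the action on $M$, restricted to $e_{\widehat k}K\langle\langle Q\rangle\rangle e_{\widehat k}\to\operatorname{End}_K(e_{\widehat k}M)$. $\theta:\operatorname{End}_K(e_{\widehat k}M)\to\operatorname{End}_K(\overline M)$ sends $f$ to $\overline M\twoheadrightarrow e_{\widehat k}M\xrightarrow{f}e_{\widehat k}M\hookrightarrow\overline M$. Every $u\in K\langle\langle\widetilde\mu_k(Q)\rangle\rangle$ is uniquely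 $$u=ze_k+u_{\widehat k}+\sum_iv_ia_i^*+\sum_jb_j^*w_j+\sum_{i,j}b_j^*x_{ij}a_i^*$$ with $z\in K$, $u_{\widehat k}\in e_{\widehat k}Ae_{\widehat k}$, $v_i\in e_{\widehat k}Ae_{t(a_i)}$, $w_j\in e_{h(b_j)}Ae_{\widehat k}$, $x_{ij}\in e_{h(b_j)}Ae_{t(a_i)}$, where $A=K\langle\langle\widetilde\mu_k(Q)\rangle\rangle$. With $\Theta:=\theta\widetilde\rho\psi\kappa$, define $$\widetilde\eta(u)=\eta(ze_k)+\Theta(u_{\widehat k})+\sum_i\Theta(v_i)\eta(a_i^* )+\sum_j\eta(b_j^* )\Theta(w_j)+\sum_{i,j}\eta(b_j^* )\Theta(x_{ij})\eta(a_i^* ).$$ *)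

(* Defs.v *)
From HB Require Import structures.
From mathcomp Require Import all_boot all_algebra.
From mathcomp Require Import boolp classical_sets functions cardinality fsbigop.

Set Implicit Arguments.
Unset Strict Implicit.
Unset Printing Implicit Defensive.

Import GRing.Theory.
Local Open Scope ring_scope.
Local Open Scope quotient_scope.

(* Restriction of scalars along a ring morphism. *)
Definition restr (R R' : pzRingType) (f : {rmorphism R -> R'})
  (M : lmodType R') : Type := M.

Section Restr.
Variables (R R' : pzRingType) (f : {rmorphism R -> R'}) (M : lmodType R').

HB.instance Definition _ := GRing.Zmodule.copy (restr f M) M.

Definition restr_scale (a : R) (m : restr f M) : restr f M := f a *: (m : M).

Fact restr_scaleA a b m :
  restr_scale a (restr_scale b m) = restr_scale (a * b) m.
Proof. by rewrite /restr_scale scalerA rmorphM. Qed.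
Fact restr_scale1 : left_id 1 restr_scale.
Proof. by move=> m; rewrite /restr_scale rmorph1 scale1r. Qed.
Fact restr_scaleDr : right_distributive restr_scale +%R.
Proof. by move=> a m m'; rewrite /restr_scale scalerDr. Qed.
Fact restr_scaleDl m : {morph restr_scale^~ m : a b / a + b}.
Proof. by move=> a b; rewrite /restr_scale rmorphD scalerDl. Qed.

HB.instance Definition _ := GRing.Zmodule_isLmodule.Build R (restr f M)
  restr_scaleA restr_scale1 restr_scaleDr restr_scaleDl.
End Restr.

Section LinearAlgebra.
Variable K : fieldType.

Section KerIm.
Variables (U V : lmodType K) (f : {linear U -> V}).

Definition kerp : {pred U} := [pred x | f x == 0].
Fact kerp_closed : submod_closed kerp.
Proof.
split=> [|a x y]; rewrite !inE ?linear0 // => /eqP fx /eqP fy.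
by rewrite linearP fx fy scaler0 addr0.
Qed.
HB.instance Definition _ := GRing.isSubmodClosed.Build K U kerp kerp_closed.

Definition imp : {pred V} := [pred y | `[< exists x, f x = y >]].
Lemma impP y : reflect (exists x, f x = y) (y \in imp).
Proof. exact: asboolP. Qed.
Fact imp_closed : submod_closed imp.
Proof.
split=> [|a x y]; first by apply/impP; exists 0; rewrite linear0.
move=> /impP[x' <-] /impP[y' <-]; apply/impP.
by exists (a *: x' + y'); rewrite linearP.
Qed.
HB.instance Definition _ := GRing.isSubmodClosed.Build K V imp imp_closed.

Variable W : submodClosed V.
Definition preimp : {pred U} := [pred x | f x \in W].
Fact preimp_closed : submod_closed preimp.
Proof.
split=> [|a x y]; rewrite !inE ?linear0 ?rpred0 // => fx fy.
by rewrite linearP rpredD ?rpredZ.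
Qed.
HB.instance Definition _ := GRing.isSubmodClosed.Build K U preimp preimp_closed.
End KerIm.

Record subsp (V : lmodType K) (W : submodClosed V) :=
  Subsp { subsp_val : V; _ : subsp_val \in W }.

Section Subsp.
Variables (V : lmodType K) (W : submodClosed V).
HB.instance Definition _ := [isSub for @subsp_val V W].
HB.instance Definition _ := [Choice of subsp W by <:].
HB.instance Definition _ := [SubChoice_isSubLmodule of subsp W by <:].
HB.instance Definition _ := GRing.Linear.copy (@subsp_val V W)
  (val : subsp W -> V).
End Subsp.

Section ToIm.
Variables (U V : lmodType K) (f : {linear U -> V}).
Fact mem_imp x : f x \in imp f.
Proof. by apply/impP; exists x. Qed.
Definition toim (x : U) : subsp (imp f) := Subsp (mem_imp x).
Fact toim_linear : linear toim.
Proof. by move=> a x y; apply: val_inj; rewrite /= linearP. Qed.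
HB.instance Definition _ :=
  GRing.isLinear.Build K U (subsp (imp f)) *:%R toim toim_linear.
End ToIm.

Definition zmodp (V : lmodType K) (W : submodClosed V) : {pred V} := W.
Fact zmodp_closed (V : lmodType K) (W : submodClosed V) :
  zmod_closed (zmodp W).
Proof.
split=> [|x y Wx Wy]; first exact: (rpred0 W).
by rewrite -[- y]scaleN1r; apply: (@rpredD V W); rewrite ?rpredZ.
Qed.
HB.instance Definition _ (V : lmodType K) (W : submodClosed V) :=
  GRing.isZmodClosed.Build V (zmodp W) (@zmodp_closed V W).

Definition quo (V : lmodType K) (W : submodClosed V) : Type :=
  Quotient.quot (zmodp W).

Section Quo.
Variables (V : lmodType K) (W : submodClosed V).
HB.instance Definition _ := GRing.Zmodule.copy (quo W) (Quotient.quot (zmodp W)).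

Definition toquo (x : V) : quo W := \pi_(Quotient.quot (zmodp W)) x.
Definition quo_repr (x : quo W) : V := repr (x : Quotient.quot (zmodp W)).
Definition quo_scale (a : K) (x : quo W) : quo W := toquo (a *: quo_repr x).

Lemma quo_reprK x : toquo (quo_repr x) = x.
Proof. exact: reprK. Qed.
Lemma toquoP x y : reflect (toquo x = toquo y) (x - y \in W).
Proof.
have -> : (x - y \in W) = (x - y \in zmodp W) by [].
by rewrite Quotient.idealrBE; apply: eqP.
Qed.
Lemma toquoD x y : toquo (x + y) = toquo x + toquo y.
Proof. exact: (raddfD \pi_(Quotient.quot (zmodp W))). Qed.
Lemma toquo_scale a x : toquo (a *: x) = quo_scale a (toquo x).
Proof.
by apply/toquoP; rewrite -scalerBr rpredZ //; apply/toquoP; rewrite quo_reprK.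
Qed.

Fact quo_scaleA a b x : quo_scale a (quo_scale b x) = quo_scale (a * b) x.
Proof. by rewrite -[x]quo_reprK -!toquo_scale scalerA. Qed.
Fact quo_scale1 : left_id 1 quo_scale.
Proof. by move=> x; rewrite -[x]quo_reprK -toquo_scale scale1r. Qed.
Fact quo_scaleDr : right_distributive quo_scale +%R.
Proof.
move=> a x y; rewrite -[x]quo_reprK -[y]quo_reprK -toquoD -!toquo_scale.
by rewrite -toquoD scalerDr.
Qed.
Fact quo_scaleDl x : {morph quo_scale^~ x : a b / a + b}.
Proof.
by move=> a b; rewrite -[x]quo_reprK -!toquo_scale -toquoD scalerDl.
Qed.
HB.instance Definition _ := GRing.Zmodule_isLmodule.Build K (quo W)
  quo_scaleA quo_scale1 quo_scaleDr quo_scaleDl.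

Fact toquo_linear : linear toquo.
Proof. by move=> a x y; rewrite toquoD toquo_scale. Qed.
HB.instance Definition _ :=
  GRing.isLinear.Build K V (quo W) *:%R toquo toquo_linear.
End Quo.

Section Pairing.
Variables (U V W : lmodType K) (f : {linear U -> V}) (g : {linear U -> W}).
Definition lpair (x : U) : V * W := (f x, g x).
Fact lpair_linear : linear lpair.
Proof. by move=> a x y; rewrite /lpair !linearP. Qed.
HB.instance Definition _ :=
  GRing.isLinear.Build K U (V * W)%type *:%R lpair lpair_linear.
End Pairing.

(* The map V/W -> U induced by f : V -> U when f vanishes on W; by convention
   the zero map otherwise. *)
Section Induced.
Variables (U V : lmodType K) (W : submodClosed V) (f : {linear V -> U}).
Definition induced (x : quo W) : U :=
  if `[< forall w, w \in W -> f w = 0 >] then f (quo_repr x) else 0.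
Fact induced_linear : linear induced.
Proof.
rewrite /induced => a x y; case: asboolP => [fW0|_]; last by rewrite scaler0 addr0.
apply/eqP; rewrite -linearP -subr_eq0 -linearB; apply/eqP/fW0; apply/toquoP.
by rewrite linearP /= !quo_reprK.
Qed.
HB.instance Definition _ :=
  GRing.isLinear.Build K (quo W) U *:%R induced induced_linear.
End Induced.

(* f with its codomain restricted to W when f takes its values in W; by
   convention the zero map otherwise. *)
Section CoRestr.
Variables (U V : lmodType K) (W : submodClosed V) (f : {linear U -> V}).
Definition corestr (x : U) : subsp W :=
  if `[< forall y, f y \in W >] then insubd 0 (f x) else 0.
Fact corestr_linear : linear corestr.
Proof.
rewrite /corestr => a x y; case: asboolP => [fW|_]; last by rewrite scaler0 addr0.
apply: val_inj; rewrite [RHS]linearP /= !insubdK ?fW //; exact: linearP.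
Qed.
HB.instance Definition _ :=
  GRing.isLinear.Build K U (subsp W) *:%R corestr corestr_linear.
End CoRestr.

(* Finite direct sum of a family of vector spaces. *)
Definition dsum (J : finType) (V : J -> lmodType K) : Type := forall j, V j.

Section Dsum.
Variables (J : finType) (V : J -> lmodType K).
HB.instance Definition _ := Choice.copy (dsum V) (forall j, V j).
Definition dsum_zero : dsum V := fun _ => 0.
Definition dsum_opp (x : dsum V) : dsum V := fun j => - x j.
Definition dsum_add (x y : dsum V) : dsum V := fun j => x j + y j.
Definition dsum_scale a (x : dsum V) : dsum V := fun j => a *: x j.

Fact dsum_addA : associative dsum_add.
Proof. by move=> x y z; apply: functional_extensionality_dep => j; apply: addrA. Qed.
Fact dsum_addC : commutative dsum_add.
Proof. by move=> x y; apply: functional_extensionality_dep => j; apply: addrC. Qed.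
Fact dsum_add0 : left_id dsum_zero dsum_add.
Proof. by move=> x; apply: functional_extensionality_dep => j; apply: add0r. Qed.
Fact dsum_addN : left_inverse dsum_zero dsum_opp dsum_add.
Proof. by move=> x; apply: functional_extensionality_dep => j; apply: addNr. Qed.
HB.instance Definition _ := GRing.isZmodule.Build (dsum V)
  dsum_addA dsum_addC dsum_add0 dsum_addN.

Fact dsum_scaleA a b x : dsum_scale a (dsum_scale b x) = dsum_scale (a * b) x.
Proof. by apply: functional_extensionality_dep => j; apply: scalerA. Qed.
Fact dsum_scale1 : left_id 1 dsum_scale.
Proof. by move=> x; apply: functional_extensionality_dep => j; apply: scale1r. Qed.
Fact dsum_scaleDr : right_distributive dsum_scale +%R.
Proof. by move=> a x y; apply: functional_extensionality_dep => j; apply: scalerDr. Qed.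
Fact dsum_scaleDl x : {morph dsum_scale^~ x : a b / a + b}.
Proof. by move=> a b; apply: functional_extensionality_dep => j; apply: scalerDl. Qed.
HB.instance Definition _ := GRing.Zmodule_isLmodule.Build K (dsum V)
  dsum_scaleA dsum_scale1 dsum_scaleDr dsum_scaleDl.

End Dsum.

(* End_K(N), as a ring under composition. *)
Section Endo.
Variable N : lmodType K.

Definition linp : {pred N -> N} := [pred f | `[< linear f >]].
Lemma linpP f : reflect (linear f) (f \in linp).
Proof. exact: asboolP. Qed.
Fact linp_closed : submod_closed linp.
Proof.
split=> [|c f g]; first by apply/linpP => a x y; rewrite /= scaler0 addr0.
move=> /linpP lf /linpP lg; apply/linpP => a x y.
have -> z : (c *: f + g) z = c *: f z + g z by [].
have -> z : (c *: f + g) z = c *: f z + g z by [].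
by rewrite lf lg !scalerDr !scalerA [c * a]mulrC addrACA.
Qed.
HB.instance Definition _ :=
  GRing.isSubmodClosed.Build K (N -> N) linp linp_closed.

Record endo := Endo { endo_fun :> N -> N; _ : endo_fun \in linp }.
HB.instance Definition _ := [isSub for endo_fun].
HB.instance Definition _ := [Choice of endo by <:].
HB.instance Definition _ := [SubChoice_isSubLmodule of endo by <:].

Fact endo_linear (f : endo) : linear f.
Proof. by case: f => f /= /linpP. Qed.
HB.instance Definition _ (f : endo) :=
  GRing.isLinear.Build K N N *:%R f (endo_linear f).

Fact linear_linp (f : {linear N -> N}) : (f : N -> N) \in linp.
Proof. by apply/linpP => a x y; rewrite linearP. Qed.
Definition to_endo (f : {linear N -> N}) : endo := Endo (linear_linp f).

Lemma endoP (f g : endo) : f =1 g -> f = g.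
Proof. by move=> fg; apply: val_inj; apply/funext. Qed.

Definition endo_one : endo := to_endo idfun.
Definition endo_mul (f g : endo) : endo := to_endo (f \o g).
Fact endo_mulA : associative endo_mul. Proof. by move=> *; apply: endoP. Qed.
Fact endo_mul1l : left_id endo_one endo_mul. Proof. by move=> *; apply: endoP. Qed.
Fact endo_mul1r : right_id endo_one endo_mul. Proof. by move=> *; apply: endoP. Qed.
Fact endo_mulDl : left_distributive endo_mul +%R.
Proof. by move=> *; apply: endoP. Qed.
Fact endo_mulDr : right_distributive endo_mul +%R.
Proof. by move=> f g h; apply: endoP => x; rewrite /= linearD. Qed.
HB.instance Definition _ := GRing.Zmodule_isPzRing.Build endo
  endo_mulA endo_mul1l endo_mul1r endo_mulDl endo_mulDr.
End Endo.

Definition findim (V : lmodType K) : Prop :=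
  exists n, inhabited (Vector.axiom n V).

End LinearAlgebra.

(* Quotient of a ring by a two-sided ideal. *)
HB.mixin Record isTwoSided (R : pzRingType) (S : R -> bool) := {
  twosided_subproof :
    forall a u, u \in (S : {pred R}) -> (a * u \in (S : {pred R})) * (u * a \in (S : {pred R}))
}.
#[short(type="twosided")]
HB.structure Definition TwoSided (R : pzRingType) :=
  {S of GRing.ZmodClosed R S & isTwoSided R S}.

Definition qring (R : pzRingType) (I : twosided R) : Type := Quotient.quot I.

Section QRing.
Variables (R : pzRingType) (I : twosided R).
HB.instance Definition _ := GRing.Zmodule.copy (qring I) (Quotient.quot I).

Definition toqring (u : R) : qring I := \pi_(Quotient.quot I) u.
Definition qring_repr (x : qring I) : R := repr (x : Quotient.quot I).
Definition qring_one : qring I := toqring 1.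
Definition qring_mul (x y : qring I) : qring I :=
  toqring (qring_repr x * qring_repr y).

Lemma qring_reprK x : toqring (qring_repr x) = x.
Proof. exact: reprK. Qed.
Lemma toqringP x y : reflect (toqring x = toqring y) (x - y \in I).
Proof. by rewrite Quotient.idealrBE; apply: eqP. Qed.
Lemma toqringB : zmod_morphism toqring.
Proof. exact: (raddfB \pi_(Quotient.quot I)). Qed.
HB.instance Definition _ := GRing.isZmodMorphism.Build R (qring I) toqring toqringB.
Lemma toqring_mul x y : toqring (x * y) = qring_mul (toqring x) (toqring y).
Proof.
apply/toqringP; set x' := qring_repr _; set y' := qring_repr _.
have -> : x * y - x' * y' = (x - x') * y + x' * (y - y').
  by rewrite mulrBl mulrBr addrA subrK.
rewrite rpredD //.
  by apply: (twosided_subproof _ _ _).2; apply/toqringP; rewrite qring_reprK.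
by apply: (twosided_subproof _ _ _).1; apply/toqringP; rewrite qring_reprK.
Qed.

Fact qring_mulA : associative qring_mul.
Proof.
move=> x y z; rewrite -[x]qring_reprK -[y]qring_reprK -[z]qring_reprK.
by rewrite -!toqring_mul mulrA.
Qed.
Fact qring_mul1l : left_id qring_one qring_mul.
Proof. by move=> x; rewrite -[x]qring_reprK -toqring_mul mul1r. Qed.
Fact qring_mul1r : right_id qring_one qring_mul.
Proof. by move=> x; rewrite -[x]qring_reprK -toqring_mul mulr1. Qed.
Fact qring_mulDl : left_distributive qring_mul +%R.
Proof.
move=> x y z; rewrite -[x]qring_reprK -[y]qring_reprK -[z]qring_reprK.
by rewrite -raddfD -!toqring_mul -raddfD mulrDl.
Qed.
Fact qring_mulDr : right_distributive qring_mul +%R.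
Proof.
move=> x y z; rewrite -[x]qring_reprK -[y]qring_reprK -[z]qring_reprK.
by rewrite -raddfD -!toqring_mul -raddfD mulrDr.
Qed.
HB.instance Definition _ := GRing.Zmodule_isPzRing.Build (qring I)
  qring_mulA qring_mul1l qring_mul1r qring_mulDl qring_mulDr.

Fact toqring_monoid : monoid_morphism toqring.
Proof. by split=> // x y; rewrite toqring_mul. Qed.
HB.instance Definition _ :=
  GRing.isMonoidMorphism.Build R (qring I) toqring toqring_monoid.
End QRing.

Section Ideals.
Local Open Scope classical_set_scope.
Variable R : pzRingType.

(* Two-sided ideal generated by G. *)
Definition idealgen (G : set R) : set R :=
  [set u | exists2 s : seq (R * R * R), {in s, forall x, G x.1.2} &
           u = \sum_(x <- s) x.1.1 * x.1.2 * x.2].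

Definition idealprod (A B : set R) : set R :=
  [set u | exists2 s : seq (R * R), {in s, forall x, A x.1 /\ B x.2} &
           u = \sum_(x <- s) x.1 * x.2].

Fixpoint idealpow (A : set R) (n : nat) : set R :=
  if n is n'.+1 then idealprod A (idealpow A n') else setT.

Definition adic_closure (A X : set R) : set R :=
  [set u | forall n, exists2 v, X v & idealpow A n (u - v)].

Definition is_ideal (A : set R) : Prop :=
  [/\ A 0, forall u v, A u -> A v -> A (u - v) &
      forall a u, A u -> A (a * u) /\ A (u * a)].

Lemma idealgen_ideal G : is_ideal (idealgen G).
Proof.
split=> [|u v|a u].
- by exists [::] => //; rewrite big_nil.
- move=> [s Gs ->] [t Gt ->].
  exists (s ++ [seq (- x.1.1, x.1.2, x.2) | x <- t]).
    by move=> x; rewrite mem_cat => /orP[/Gs|/mapP[y /Gt Gy ->]].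
  rewrite big_cat big_map -sumrN; congr (_ + _).
  by apply: eq_bigr => x _; rewrite !mulNr.
move=> [s Gs ->]; split.
  exists [seq (a * x.1.1, x.1.2, x.2) | x <- s].
    by move=> x /mapP[y /Gs Gy ->].
  by rewrite big_map mulr_sumr; apply: eq_bigr => x _; rewrite !mulrA.
exists [seq (x.1.1, x.1.2, x.2 * a) | x <- s].
  by move=> x /mapP[y /Gs Gy ->].
by rewrite big_map mulr_suml; apply: eq_bigr => x _; rewrite !mulrA.
Qed.

Lemma idealprod_ideal A B : is_ideal A -> is_ideal B -> is_ideal (idealprod A B).
Proof.
move=> [A0 AB Am] [B0 BB Bm]; split=> [|u v|a u].
- by exists [::] => //; rewrite big_nil.
- move=> [s Gs ->] [t Gt ->].
  exists (s ++ [seq (- x.1, x.2) | x <- t]).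
    move=> x; rewrite mem_cat => /orP[/Gs //|/mapP[y /Gt[Ay By] ->]].
    by split=> //=; rewrite -[- _]add0r; apply: AB.
  rewrite big_cat big_map -sumrN; congr (_ + _).
  by apply: eq_bigr => x _; rewrite !mulNr.
move=> [s Gs ->]; split.
  exists [seq (a * x.1, x.2) | x <- s].
    by move=> x /mapP[y /Gs[Ay By] ->]; split=> //=; apply: (Am _ _ _).1.
  by rewrite big_map mulr_sumr; apply: eq_bigr => x _; rewrite !mulrA.
exists [seq (x.1, x.2 * a) | x <- s].
  by move=> x /mapP[y /Gs[Ay By] ->]; split=> //=; apply: (Bm _ _ _).2.
by rewrite big_map mulr_suml; apply: eq_bigr => x _; rewrite !mulrA.
Qed.

Lemma idealpow_ideal A n : is_ideal A -> is_ideal (idealpow A n).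
Proof. by move=> hA; elim: n => [|n IH]; [split | apply: idealprod_ideal]. Qed.

Lemma adic_closure_ideal A X :
  is_ideal A -> is_ideal X -> is_ideal (adic_closure A X).
Proof.
move=> hA [X0 XB Xm]; split=> [n|u v hu hv n|a u hu].
- by exists 0; rewrite // subr0; case: (idealpow_ideal n hA).
- have [_ AB _] := idealpow_ideal n hA.
  have [u' Xu Au] := hu n; have [v' Xv Av] := hv n.
  exists (u' - v'); first exact: XB.
  have -> : u - v - (u' - v') = (u - u') - (v - v').
    by rewrite !opprD !opprK addrACA.
  exact: AB.
split=> n; have [_ _ Am] := idealpow_ideal n hA; have [u' Xu Au] := hu n.
  by exists (a * u'); [apply: (Xm _ _ _).1 | rewrite -mulrBr; apply: (Am _ _ _).1].
by exists (u' * a); [apply: (Xm _ _ _).2 | rewrite -mulrBl; apply: (Am _ _ _).2].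
Qed.
End Ideals.

(* Finite quivers with vertex set I; an arrow a goes from tl a to hd a. *)
Structure quiver (I : finType) :=
  Quiver { arrow :> finType; hd : arrow -> I; tl : arrow -> I }.
Arguments hd {I q}.
Arguments tl {I q}.

Definition loop_free (I : finType) (Q : quiver I) : Prop :=
  forall a : Q, hd a != tl a.

Section PathAlgebra.
Variables (K : fieldType) (I : finType) (Q : quiver I).
Implicit Types (i j : I) (s : seq Q).

(* (i, [:: c_1; ..; c_d]) is the path c_1 .. c_d with head i: the head of c_1
   is i and tl c_n = hd c_(n+1); (i, [::]) is the path e_i. *)
Fixpoint pathb i s : bool :=
  if s is a :: s' then (hd a == i) && pathb (tl a) s' else true.

Record qpath := QPath { qpval : I * seq Q; _ : pathb qpval.1 qpval.2 }.
HB.instance Definition _ := [isSub for qpval].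
HB.instance Definition _ := [Countable of qpath by <:].

Definition ph (p : qpath) : I := (val p).1.
Definition ps (p : qpath) : seq Q := (val p).2.
Definition stail i s : I := last i (map tl s).
Definition pt (p : qpath) : I := stail (ph p) (ps p).
Definition plen (p : qpath) : nat := size (ps p).

Lemma stail_cat i s s' : stail i (s ++ s') = stail (stail i s) s'.
Proof. by rewrite /stail map_cat last_cat. Qed.
Lemma pathb_cat i s s' :
  pathb i (s ++ s') = pathb i s && pathb (stail i s) s'.
Proof. by elim: s i => //= a s IH i; rewrite IH andbA. Qed.

Lemma qpathP p : pathb (ph p) (ps p). Proof. exact: (valP p). Qed.
Lemma ptake_subproof n p : pathb (ph p) (take n (ps p)).
Proof.
by have := qpathP p; rewrite -{1}(cat_take_drop n (ps p)) pathb_cat => /andP[].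
Qed.
Lemma pdrop_subproof n p :
  pathb (stail (ph p) (take n (ps p))) (drop n (ps p)).
Proof.
by have := qpathP p; rewrite -{1}(cat_take_drop n (ps p)) pathb_cat => /andP[].
Qed.
Definition ptake n p : qpath := @QPath (_, _) (ptake_subproof n p).
Definition pdrop n p : qpath := @QPath (_, _) (pdrop_subproof n p).

(* The complete path algebra: u : cpa stands for the possibly infinite
   combination of the paths p with coefficients u p. *)
Definition cpa : Type := qpath -> K.

HB.instance Definition _ := GRing.Lmodule.copy cpa (qpath -> K^o).

Definition cpa_one : cpa := fun p => (plen p == 0%N)%:R.
Definition cpa_mul (u v : cpa) : cpa :=
  fun p => \sum_(n < (plen p).+1) u (ptake n p) * v (pdrop n p).

Lemma cpaE (u v : cpa) : u =1 v -> u = v.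
Proof. by move=> uv; apply/funext. Qed.
Lemma cpaD (u v : cpa) p : (u + v) p = u p + v p. Proof. by []. Qed.

Lemma plen_take n p : (n <= plen p)%N -> plen (ptake n p) = n.
Proof. by move=> np; rewrite /plen /= size_takel. Qed.
Lemma plen_drop n p : plen (pdrop n p) = (plen p - n)%N.
Proof. by rewrite /plen /= size_drop. Qed.

Lemma ptake0 p : val (ptake 0 p) = (ph p, [::]).
Proof. by rewrite /= take0. Qed.
Lemma pdrop0 p : pdrop 0 p = p.
Proof. by apply: val_inj; case: p => -[i s] ?; rewrite /= take0 drop0. Qed.
Lemma ptake_oversize n p : (plen p <= n)%N -> ptake n p = p.
Proof.
by move=> pn; apply: val_inj; rewrite /= take_oversize //; case: p pn => -[].
Qed.

Lemma sum_triangle (n : nat) (G : nat -> nat -> K) :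
  \sum_(m < n) \sum_(l < m.+1) G l (m - l)%N =
  \sum_(l < n) \sum_(m < n - l) G l m.
Proof.
elim: n => [|n IH]; first by rewrite !big_ord0.
rewrite big_ord_recr /= IH [RHS]big_ord_recr /= subSnn big_ord1.
rewrite big_ord_recr /= subnn addrA; congr (_ + _).
rewrite -big_split /=; apply: eq_bigr => l _.
by rewrite subSn 1?ltnW // big_ord_recr.
Qed.

Fact cpa_mulA : associative cpa_mul.
Proof.
move=> u v w; apply: cpaE => p; rewrite /cpa_mul; set L := (plen p).+1.
pose G l m := u (ptake l p) * v (ptake m (pdrop l p)) * w (pdrop (l + m) p).
transitivity (\sum_(l < L) \sum_(m < L - l) G l m); last first.
  rewrite -sum_triangle; apply: eq_bigr => m _.
  rewrite plen_take; last by rewrite -ltnS.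
  rewrite mulr_suml; apply: eq_bigr => l _.
  have lm : (l <= m)%N by rewrite -ltnS.
  rewrite /G subnKC //; congr (u _ * v _ * _); apply: val_inj => /=.
    by rewrite take_takel.
  rewrite /= take_takel //; congr (_, _).
  by rewrite take_drop subnK.
apply: eq_bigr => l _; rewrite plen_drop mulr_sumr subSn; last by rewrite -ltnS.
apply: eq_bigr => m _; rewrite mulrA; congr (_ * w _); apply: val_inj => /=.
rewrite drop_drop [(m + l)%N]addnC; congr (_, _).
by rewrite -stail_cat takeD.
Qed.

Fact cpa_mul1l : left_id cpa_one cpa_mul.
Proof.
move=> u; apply: cpaE => p; rewrite /cpa_mul big_ord_recl pdrop0.
rewrite /cpa_one plen_take // eqxx mul1r big1 ?addr0 // => n _.
by rewrite lift0 plen_take // mul0r.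
Qed.

Fact cpa_mul1r : right_id cpa_one cpa_mul.
Proof.
move=> u; apply: cpaE => p; rewrite /cpa_mul big_ord_recr /= /cpa_one.
rewrite plen_drop subnn eqxx mulr1 ptake_oversize // big1 ?add0r // => n _.
by rewrite plen_drop subn_eq0 leqNgt ltn_ord mulr0.
Qed.

Fact cpa_mulDl : left_distributive cpa_mul +%R.
Proof.
move=> u v w; apply: cpaE => p; rewrite cpaD /cpa_mul -big_split.
by apply: eq_bigr => n _; rewrite cpaD mulrDl.
Qed.
Fact cpa_mulDr : right_distributive cpa_mul +%R.
Proof.
move=> u v w; apply: cpaE => p; rewrite cpaD /cpa_mul -big_split.
by apply: eq_bigr => n _; rewrite cpaD mulrDr.
Qed.
HB.instance Definition _ := GRing.Zmodule_isPzRing.Build cpa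
  cpa_mulA cpa_mul1l cpa_mul1r cpa_mulDl cpa_mulDr.

Lemma cpaZ c (u : cpa) p : (c *: u) p = c * u p. Proof. by []. Qed.
Lemma cpaM (u v : cpa) p :
  (u * v) p = \sum_(n < (plen p).+1) u (ptake n p) * v (pdrop n p).
Proof. by []. Qed.

Lemma cpa_scaleAl c (u v : cpa) : c *: (u * v) = (c *: u) * v.
Proof.
apply: cpaE => p; rewrite cpaZ !cpaM mulr_sumr.
by apply: eq_bigr => n _; rewrite cpaZ mulrA.
Qed.
Lemma cpa_scaleAr c (u v : cpa) : c *: (u * v) = u * (c *: v).
Proof.
apply: cpaE => p; rewrite cpaZ !cpaM mulr_sumr.
by apply: eq_bigr => n _; rewrite cpaZ mulrCA.
Qed.

(* The path x.2 with head x.1; 0 if this is not a path. *)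
Definition pathelt (x : I * seq Q) : cpa := fun p => (val p == x)%:R.
Definition idem i : cpa := pathelt (i, [::]).
Definition arr (a : Q) : cpa := pathelt (hd a, [:: a]).

(* The coefficient in u of the path s with head i; 0 if this is not a path. *)
Definition coef (u : cpa) i s : K := oapp u 0 (insub (i, s)).

Local Open Scope classical_set_scope.
Definition in_path_algebra (u : cpa) : Prop := finite_set [set p | u p != 0].

Definition arrow_ideal : set cpa := idealgen (range arr).

Definition potential (S : cpa) : Prop :=
  forall p, S p != 0 -> (0 < plen p)%N /\ ph p = pt p.
End PathAlgebra.

Arguments cpa K {I} Q.
Arguments pathelt K {I Q} x.
Arguments idem {K I Q} i.
Arguments arr {K I Q} a.
Arguments arrow_ideal {K I Q}.

(* Extension by linearity and continuity of a map given on paths: f(u) is the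
   sum of the u_q f(q), computed coefficientwise. *)
Definition linext (K : fieldType) (I J : finType) (Q : quiver I)
  (Q' : quiver J) (f : qpath Q -> cpa K Q') (u : cpa K Q) : cpa K Q' :=
  fun p => \sum_(q \in classical_sets.setT) u q * f q p.

Section Derivatives.
Variables (K : fieldType) (I : finType) (Q : quiver I).

(* On a cyclic path c_1 .. c_d, rot n lists c_(n+1) .. c_d c_1 .. c_n. *)
Definition dpath (a : Q) (c : qpath Q) : cpa K Q :=
  \sum_(n < plen c)
    if rot n (ps c) is a' :: s then
      if a' == a then pathelt K (tl a, s) else 0
    else 0.
Definition cder (a : Q) : cpa K Q -> cpa K Q := linext (dpath a).

Definition d2path (b a : Q) (c : qpath Q) : cpa K Q :=
  \sum_(n < plen c)
    if rot n (ps c) is b' :: a' :: s then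
      if (b' == b) && (a' == a) then pathelt K (tl a, s) else 0
    else 0.
Definition cder2 (b a : Q) : cpa K Q -> cpa K Q := linext (d2path b a).

Local Open Scope classical_set_scope.
Variable S : cpa K Q.

Definition jacset : set (cpa K Q) :=
  adic_closure arrow_ideal (idealgen (range (fun a => cder a S))).
Definition jacideal : {pred cpa K Q} := [pred u | `[< jacset u >]].

Lemma jacideal_ideal : is_ideal jacset.
Proof. by apply: adic_closure_ideal; apply: idealgen_ideal. Qed.
Fact jacideal_zmod : zmod_closed jacideal.
Proof.
have [J0 JB _] := jacideal_ideal.
by split=> [|u v /asboolP hu /asboolP hv]; apply/asboolP => //; apply: JB.
Qed.
HB.instance Definition _ :=
  GRing.isZmodClosed.Build (cpa K Q) jacideal jacideal_zmod.
Fact jacideal_twosided a u : u \in jacideal ->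
  (a * u \in jacideal) * (u * a \in jacideal).
Proof.
have [_ _ Jm] := jacideal_ideal.
by move=> /asboolP /(Jm a) [hl hr]; split; apply/asboolP.
Qed.
HB.instance Definition _ :=
  isTwoSided.Build (cpa K Q) jacideal jacideal_twosided.

(* P(Q,S) *)
Definition jac : pzRingType := qring jacideal.

Definition tojac (u : cpa K Q) : jac := toqring jacideal u.
Definition jac_scalar (c : K) : jac := tojac (c *: (1 : cpa K Q)).

Fact jac_scalar_zmod : zmod_morphism jac_scalar.
Proof. by move=> c d; rewrite /jac_scalar scalerBl; apply: (raddfB (toqring _)). Qed.
HB.instance Definition _ := GRing.isZmodMorphism.Build K jac jac_scalar jac_scalar_zmod.
Fact jac_scalar_monoid : monoid_morphism jac_scalar.
Proof.
split=> [|c d]; rewrite /jac_scalar; first by rewrite scale1r; apply: (rmorph1 (toqring _)).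
rewrite -[RHS](rmorphM (toqring _)); congr tojac.
by rewrite -cpa_scaleAl -cpa_scaleAr mulr1 scalerA.
Qed.
HB.instance Definition _ :=
  GRing.isMonoidMorphism.Build K jac jac_scalar jac_scalar_monoid.
End Derivatives.

Section Premutation.
Variables (I : finType) (Q : quiver I) (k : I).

Definition plain := {c : Q | (hd c != k) && (tl c != k)}.
Definition inar := {a : Q | hd a == k}.
Definition outar := {b : Q | tl b == k}.

(* The arrows of the premutation at k: c, [ba], a^* and b^*, for c not incident
   to k, a ending at k and b starting at k.  When Q has no loops, each arrow
   incident to k gives rise to exactly one starred arrow. *)
Inductive parrow :=
  | Plain of plain
  | Comp of outar & inar
  | StarIn of inar
  | StarOut of outar.

Definition parrow_enc (x : parrow) : plain + outar * inar + (inar + outar) :=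
  match x with
  | Plain c => inl (inl c)
  | Comp b a => inl (inr (b, a))
  | StarIn a => inr (inl a)
  | StarOut b => inr (inr b)
  end.
Definition parrow_dec (x : plain + outar * inar + (inar + outar)) : parrow :=
  match x with
  | inl (inl c) => Plain c
  | inl (inr (b, a)) => Comp b a
  | inr (inl a) => StarIn a
  | inr (inr b) => StarOut b
  end.
Lemma parrow_encK : cancel parrow_enc parrow_dec. Proof. by case. Qed.
HB.instance Definition _ := Finite.copy parrow (can_type parrow_encK).

Definition phd (x : parrow) : I :=
  match x with
  | Plain c => hd (val c)
  | Comp b a => hd (val b)
  | StarIn a => tl (val a)
  | StarOut b => tl (val b)
  end.
Definition ptl (x : parrow) : I :=
  match x with
  | Plain c => tl (val c)
  | Comp b a => tl (val a)
  | StarIn a => hd (val a)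
  | StarOut b => hd (val b)
  end.
Definition premut : quiver I := Quiver phd ptl.

(* Q with the vertex k and all arrows incident to k deleted. *)
Definition del_hd (c : plain) : {j | j != k} :=
  Sub (hd (val c)) (proj1 (andP (valP c))).
Definition del_tl (c : plain) : {j | j != k} :=
  Sub (tl (val c)) (proj2 (andP (valP c))).
Definition del : quiver {j | j != k} := Quiver del_hd del_tl.
End Premutation.

Section Psi.
Variables (K : fieldType) (I : finType) (Q : quiver I) (k : I).
Notation Q1 := (premut Q k).
Notation Q2 := (del (premut Q1 k) k).

(* The path of premut Q k corresponding to an arrow of Q2: [a^* b^*] is expanded
   into a^* b^*.  The starred arrows of premut Q1 k do not occur in Q2. *)
Definition expand_arrow (c : Q2) : seq Q1 :=
  match val c with
  | Plain z => [:: val z]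
  | Comp x y => [:: val x; val y]
  | _ => [::]
  end.
Definition expand_seq (s : seq Q2) : seq Q1 := flatten (map expand_arrow s).

Lemma expand_arrowP (c : Q2) :
  pathb (val (hd c)) (expand_arrow c) /\
  stail (val (hd c)) (expand_arrow c) = val (tl c).
Proof.
case: c => -[z|[x xk] [y yk]|[x xk]|[x xk]] cP /=.
- by rewrite eqxx.
- have /= -> := eqP xk; have /= -> := eqP yk.
  by rewrite !eqxx.
- by case/andP: (cP) => /= _ /negP[].
- by case/andP: (cP) => /= /negP[].
Qed.

Lemma expand_seqP (i : {j | j != k}) (s : seq Q2) :
  pathb i s -> pathb (val i) (expand_seq s).
Proof.
elim: s i => //= c s IH i /andP[/eqP <- cs].
have [hP tP] := expand_arrowP c.
by rewrite /expand_seq /= pathb_cat hP tP; apply: IH.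
Qed.

Definition expand (q : qpath Q2) : qpath Q1 :=
  @QPath _ Q1 (val (ph q), expand_seq (ps q)) (expand_seqP (qpathP q)).

(* expand is a bijection from the paths of Q2 onto the paths of Q1 with both
   endpoints different from k; its inverse replaces each a^* b^* by the arrow
   [a^* b^*].  Paths with an endpoint at k are ignored by kappa. *)
Definition kappa (u : cpa K Q1) : cpa K Q2 := fun q => u (expand q).

Definition idemhat : cpa K Q := 1 - idem k.

Variable S : cpa K Q.

(* The cases sent to 0 do not occur when Q has no loops. *)
Definition psi_arrow (c : Q2) : cpa K Q :=
  match val c with
  | Plain z =>
      match val z with
      | Plain c => arr (val c)
      | Comp b a => arr (val b) * arr (val a)
      | _ => 0
      end
  | Comp x y =>
      match val x, val y with
      | StarIn a, StarOut b => - cder2 (val b) (val a) S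
      | _, _ => 0
      end
  | _ => 0
  end.
Definition psi_path (q : qpath Q2) : cpa K Q :=
  idem (val (ph q)) * \prod_(c <- ps q) psi_arrow c.
Definition psi : cpa K Q2 -> cpa K Q := linext psi_path.
End Psi.
Arguments idemhat K {I} Q k.

(* The components of an element u of K<<premut Q k>> in
   u = z e_k + u_hat + sum_a v_a a^* + sum_b b^* w_b + sum_(a, b) b^* x_ab a^*. *)
Section Components.
Variables (K : fieldType) (I : finType) (Q : quiver I) (k : I).
Notation Q1 := (premut Q k).
Variable u : cpa K Q1.

Definition compz : K := coef u k [::].
Definition comphat : cpa K Q1 := idemhat K Q1 k * u * idemhat K Q1 k.
Definition compv (a : inar Q k) : cpa K Q1 := fun p =>
  if (ph p != k) && (pt p == tl (val a))
  then coef u (ph p) (rcons (ps p) (StarIn a : Q1)) else 0.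
Definition compw (b : outar Q k) : cpa K Q1 := fun p =>
  if (ph p == hd (val b)) && (pt p != k)
  then coef u k ((StarOut b : Q1) :: ps p) else 0.
Definition compx (a : inar Q k) (b : outar Q k) : cpa K Q1 := fun p =>
  if (ph p == hd (val b)) && (pt p == tl (val a))
  then coef u k ((StarOut b : Q1) :: rcons (ps p) (StarIn a : Q1)) else 0.
End Components.

Section Modules.
Variables (K : fieldType) (I : finType) (Q : quiver I) (S : cpa K Q).
Variable M : lmodType (jac S).

Definition kmod : lmodType K := restr (@jac_scalar K I Q S) M.

Definition act (u : cpa K Q) (m : kmod) : kmod := tojac S u *: (m : M).
Fact act_linear u : linear (act u).
Proof.
move=> c x y.
change (tojac S u *: (jac_scalar S c *: (x : M) + (y : M)) =
  jac_scalar S c *: (tojac S u *: (x : M)) + tojac S u *: (y : M)).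
rewrite scalerDr !scalerA; congr (_ + _); congr (_ *: _).
rewrite /jac_scalar /tojac -!(rmorphM (toqring _)); congr (toqring _ _).
by rewrite -cpa_scaleAl -cpa_scaleAr mul1r mulr1.
Qed.
HB.instance Definition _ u :=
  GRing.isLinear.Build K kmod kmod *:%R (act u) (act_linear u).

(* M_j = e_j M, with the projection m |-> e_j m and the inclusion *)
Definition im_idem (j : I) : submodClosed kmod := imp (act (idem j)).
Definition Mv (j : I) : lmodType K := subsp (im_idem j).
Definition to_Mv (j : I) : {linear kmod -> Mv j} := @toim K kmod kmod (act (idem j)).
Definition iota_Mv (j : I) : {linear Mv j -> kmod} := @subsp_val K kmod (im_idem j).

Variable k : I.
(* e_khat M, the sum of the M_j with j <> k *)
Definition im_idemhat : submodClosed kmod := imp (act (idemhat K Q k)).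
Definition Mhat : lmodType K := subsp im_idemhat.
Definition to_Mhat : {linear kmod -> Mhat} :=
  @toim K kmod kmod (act (idemhat K Q k)).
Definition iota_Mhat : {linear Mhat -> kmod} := @subsp_val K kmod im_idemhat.

Definition Min : lmodType K := dsum (fun a : inar Q k => Mv (tl (val a))).
Definition Mout : lmodType K := dsum (fun b : outar Q k => Mv (hd (val b))).

Definition alpha (x : Min) : Mv k :=
  to_Mv k (\sum_(a : inar Q k) act (arr (val a)) (iota_Mv _ (x a))).
Definition beta (y : Mv k) : Mout :=
  fun b => to_Mv (hd (val b)) (act (arr (val b)) (iota_Mv _ y)).
Definition gamma (x : Mout) : Min :=
  fun a => to_Mv (tl (val a))
    (\sum_(b : outar Q k) act (cder2 (val b) (val a) S) (iota_Mv _ (x b))).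

Lemma dsumP (J : finType) (W : J -> lmodType K) c (x y : dsum W) j :
  (c *: x + y) j = c *: x j + y j.
Proof. by []. Qed.

Fact alpha_linear : linear alpha.
Proof.
move=> c x y; rewrite /alpha -linearP scaler_sumr -big_split.
by congr (to_Mv _ _); apply: eq_bigr => a _; rewrite dsumP !linearP.
Qed.
HB.instance Definition _ :=
  GRing.isLinear.Build K Min (Mv k) *:%R alpha alpha_linear.
Fact beta_linear : linear beta.
Proof.
move=> c x y; apply: functional_extensionality_dep => b.
by rewrite dsumP /beta !linearP.
Qed.
HB.instance Definition _ :=
  GRing.isLinear.Build K (Mv k) Mout *:%R beta beta_linear.
Fact gamma_linear : linear gamma.
Proof.
move=> c x y; apply: functional_extensionality_dep => a.
rewrite dsumP /gamma -linearP scaler_sumr -big_split.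
by congr (to_Mv _ _); apply: eq_bigr => b _; rewrite dsumP !linearP.
Qed.
HB.instance Definition _ :=
  GRing.isLinear.Build K Mout Min *:%R gamma gamma_linear.

(* Kernels and images, and their traces on the kernels, as subspaces. *)
Definition ker_alpha : submodClosed Min := kerp alpha.
Definition ker_beta : submodClosed (Mv k) := kerp beta.
Definition ker_gamma : submodClosed Mout := kerp gamma.
Definition im_alpha : submodClosed (Mv k) := imp alpha.
Definition im_beta : submodClosed Mout := imp beta.
Definition im_gamma : submodClosed Min := imp gamma.

Definition kera : lmodType K := subsp ker_alpha.
Definition kerb : lmodType K := subsp ker_beta.
Definition kerg : lmodType K := subsp ker_gamma.
Definition img : lmodType K := subsp im_gamma.

Definition iota_kera : {linear kera -> Min} := @subsp_val K Min ker_alpha.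
Definition iota_kerb : {linear kerb -> Mv k} := @subsp_val K (Mv k) ker_beta.
Definition iota_kerg : {linear kerg -> Mout} := @subsp_val K Mout ker_gamma.
Definition iota_img : {linear img -> Min} := @subsp_val K Min im_gamma.

Definition im_gamma_in_kera : submodClosed kera := preimp iota_kera im_gamma.
Definition im_alpha_in_kerb : submodClosed kerb := preimp iota_kerb im_alpha.
Definition im_beta_in_kerg : submodClosed kerg := preimp iota_kerg im_beta.

Definition cokerb : lmodType K := quo im_beta.
Definition kera_img : lmodType K := quo im_gamma_in_kera.
Definition kerb_ima : lmodType K := quo im_alpha_in_kerb.
Definition kerg_imb : lmodType K := quo im_beta_in_kerg.

Definition pi_cokerb : {linear Mout -> cokerb} := @toquo K Mout im_beta.
Definition pi_kera : {linear kera -> kera_img} := @toquo K kera im_gamma_in_kera.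
Definition pi_kerg : {linear kerg -> kerg_imb} := @toquo K kerg im_beta_in_kerg.
Definition gamma_img : {linear Mout -> img} := @toim K Mout Min gamma.
Definition gamma_kera : {linear Mout -> kera} := @corestr K Mout Min ker_alpha gamma.
Definition gammabar : {linear cokerb -> Min} := @induced K Min Mout im_beta gamma.

Definition is_retraction (rho : {linear Mout -> kerg}) : Prop :=
  forall x : kerg, rho (iota_kerg x) = x.
Definition is_section (sigma : {linear kera_img -> kera}) : Prop :=
  forall x : kera_img, pi_kera (sigma x) = x.
End Modules.
Arguments alpha {K I Q S} M k x.
Arguments beta {K I Q S} M k y.
Arguments gamma {K I Q S} M k x.
Arguments to_Mv {K I Q S} M j.
Arguments iota_Mv {K I Q S} M j.
Arguments to_Mhat {K I Q S} M k.
Arguments iota_Mhat {K I Q S} M k.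

(* K^I-modules as vector spaces. *)
Section VertexModules.
Variables (K : fieldType) (I : finType).

Definition cstf (c : K) : {ffun I -> K} := [ffun => c].
Fact cstf_zmod : zmod_morphism cstf.
Proof. by move=> c d; apply/ffunP => i; rewrite !ffunE. Qed.
HB.instance Definition _ := GRing.isZmodMorphism.Build K {ffun I -> K} cstf cstf_zmod.
Fact cstf_monoid : monoid_morphism cstf.
Proof. by split=> [|c d]; apply/ffunP => i; rewrite !ffunE. Qed.
HB.instance Definition _ :=
  GRing.isMonoidMorphism.Build K {ffun I -> K} cstf cstf_monoid.

Definition videm (j : I) : {ffun I -> K} := [ffun i => (i == j)%:R].

Variable V : lmodType {ffun I -> K}.
Definition kvmod : lmodType K := restr cstf V.
Definition vact (f : {ffun I -> K}) (v : kvmod) : kvmod := f *: (v : V).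
Fact vact_linear f : linear (vact f).
Proof.
move=> c x y.
change (f *: (cstf c *: (x : V) + (y : V)) =
  cstf c *: (f *: (x : V)) + f *: (y : V)).
rewrite scalerDr !scalerA; congr (_ + _); congr (_ *: _).
by apply/ffunP => i; rewrite !ffunE mulrC.
Qed.
HB.instance Definition _ f :=
  GRing.isLinear.Build K kvmod kvmod *:%R (vact f) (vact_linear f).

(* V_k and the sum of the V_j with j <> k. *)
Definition Vv (k : I) : lmodType K := subsp (imp (vact (videm k))).
Definition Vhat (k : I) : lmodType K := subsp (imp (vact (1 - videm k))).
End VertexModules.

Variant description := DescA | DescB | DescC.

Section Mutation.
Variables (K : fieldType) (I : finType) (Q : quiver I) (S : cpa K Q).
Variables (M : lmodType (jac S)) (V : lmodType {ffun I -> K}) (k : I).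
Variable rho : {linear Mout M k -> kerg M k}.
Variable sigma : {linear kera_img M k -> kera M k}.
Notation Q1 := (premut Q k).
Notation Vk := (Vv V k).

Definition MbarkA : lmodType K :=
  (kerg_imb M k * img M k * kera_img M k * Vk)%type.
Definition MbarkB : lmodType K := (kerg_imb M k * kera M k * Vk)%type.
Definition MbarkC : lmodType K := (cokerb M k * kera_img M k * Vk)%type.

Definition alphabarA (x : Mout M k) : MbarkA :=
  (- pi_kerg M k (rho x), - gamma_img M k x, 0, 0).
Definition betabarA (y : MbarkA) : Min M k :=
  iota_img M k y.1.1.2 + iota_kera M k (sigma y.1.2).

Definition alphabarB (x : Mout M k) : MbarkB :=
  (- pi_kerg M k (rho x), - gamma_kera M k x, 0).
Definition betabarB (y : MbarkB) : Min M k := iota_kera M k y.1.2.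

Definition alphabarC (x : Mout M k) : MbarkC := (- pi_cokerb M k x, 0, 0).
Definition betabarC (y : MbarkC) : Min M k :=
  gammabar M k y.1.1 + iota_kera M k (sigma y.1.2).

Let add00 (W : lmodType K) (c : K) : 0 = c *: (0 : W) + 0.
Proof. by rewrite scaler0 addr0. Qed.

Fact alphabarA_linear : linear alphabarA.
Proof.
pose g1 : {linear Mout M k -> kerg_imb M k} := pi_kerg M k \o rho.
pose f1 : {linear Mout M k -> kerg_imb M k} := \- g1.
pose f2 : {linear Mout M k -> img M k} := \- (gamma_img M k).
exact: (linearP (lpair (lpair (lpair f1 f2) \0) \0)).
Qed.
Fact alphabarB_linear : linear alphabarB.
Proof.
pose g1 : {linear Mout M k -> kerg_imb M k} := pi_kerg M k \o rho.
pose f1 : {linear Mout M k -> kerg_imb M k} := \- g1.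
pose f2 : {linear Mout M k -> kera M k} := \- (gamma_kera M k).
exact: (linearP (lpair (lpair f1 f2) \0)).
Qed.
Fact alphabarC_linear : linear alphabarC.
Proof.
pose f : {linear Mout M k -> cokerb M k} := \- (pi_cokerb M k).
exact: (linearP (lpair (lpair f \0) \0)).
Qed.
Fact betabarA_linear : linear betabarA.
Proof.
move=> c x y; rewrite /betabarA.
rewrite (linearP (iota_img M k)) (linearP sigma) (linearP (iota_kera M k)).
by rewrite scalerDr addrACA.
Qed.
Fact betabarB_linear : linear betabarB.
Proof. by move=> c x y; apply: (linearP (iota_kera M k)). Qed.
Fact betabarC_linear : linear betabarC.
Proof.
move=> c x y; rewrite /betabarC.
rewrite (linearP (gammabar M k)) (linearP sigma) (linearP (iota_kera M k)).
by rewrite scalerDr addrACA.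
Qed.
HB.instance Definition _ :=
  GRing.isLinear.Build K (Mout M k) MbarkA *:%R alphabarA alphabarA_linear.
HB.instance Definition _ :=
  GRing.isLinear.Build K (Mout M k) MbarkB *:%R alphabarB alphabarB_linear.
HB.instance Definition _ :=
  GRing.isLinear.Build K (Mout M k) MbarkC *:%R alphabarC alphabarC_linear.
HB.instance Definition _ :=
  GRing.isLinear.Build K MbarkA (Min M k) *:%R betabarA betabarA_linear.
HB.instance Definition _ :=
  GRing.isLinear.Build K MbarkB (Min M k) *:%R betabarB betabarB_linear.
HB.instance Definition _ :=
  GRing.isLinear.Build K MbarkC (Min M k) *:%R betabarC betabarC_linear.

Definition Mbark (d : description) : lmodType K :=
  match d with DescA => MbarkA | DescB => MbarkB | DescC => MbarkC end.
Definition alphabar (d : description) : {linear Mout M k -> Mbark d} :=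
  match d with
  | DescA => alphabarA | DescB => alphabarB | DescC => alphabarC
  end.
Definition betabar (d : description) : {linear Mbark d -> Min M k} :=
  match d with
  | DescA => betabarA | DescB => betabarB | DescC => betabarC
  end.

Definition Vbar : lmodType K := (Vhat V k * kerb_ima M k)%type.

Variable d : description.

(* The sum of the Mbar_j = M_j for j <> k is Mhat. *)
Definition Mbar : lmodType K := (Mhat M k * Mbark d)%type.

(* The projection of Mbar onto Mbar_j. *)
Definition idembar_fun (j : I) (x : Mbar) : Mbar :=
  (to_Mhat M k (act (idem j) (iota_Mhat M k x.1)),
   if j == k then x.2 else 0).
Fact idembar_linear j : linear (idembar_fun j).
Proof.
move=> c x y; rewrite /idembar_fun !linearP; congr (_, _).
by case: (j == k) => //; exact: add00.
Qed.
HB.instance Definition _ j :=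
  GRing.isLinear.Build K Mbar Mbar *:%R (idembar_fun j) (idembar_linear j).
Definition idembar (j : I) : endo Mbar := to_endo (idembar_fun j).

Definition theta_fun (f : endo (Mhat M k)) (x : Mbar) : Mbar := (f x.1, 0).
Fact theta_linear f : linear (theta_fun f).
Proof. by move=> c x y; rewrite /theta_fun !linearP; congr (_, _); exact: add00. Qed.
HB.instance Definition _ f :=
  GRing.isLinear.Build K Mbar Mbar *:%R (theta_fun f) (theta_linear f).
Definition theta (f : endo (Mhat M k)) : endo Mbar := to_endo (theta_fun f).

(* The action of u on e_khat M; for u in e_khat K<<Q>> e_khat, act u preserves
   e_khat M and the projection is the identity on its image. *)
Definition rhotilde_fun (u : cpa K Q) (x : Mhat M k) : Mhat M k :=
  to_Mhat M k (act u (iota_Mhat M k x)).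
Fact rhotilde_linear u : linear (rhotilde_fun u).
Proof. by move=> c x y; rewrite /rhotilde_fun !linearP. Qed.
HB.instance Definition _ u := GRing.isLinear.Build K (Mhat M k) (Mhat M k) *:%R
  (rhotilde_fun u) (rhotilde_linear u).
Definition rhotilde (u : cpa K Q) : endo (Mhat M k) := to_endo (rhotilde_fun u).

(* a^* : Mbar_k -> M_t(a) is the component of betabar at a. *)
Definition starin_fun (a : inar Q k) (x : Mbar) : Mbar :=
  (to_Mhat M k (iota_Mv M _ (betabar d x.2 a)), 0).
Fact starin_linear a : linear (starin_fun a).
Proof.
move=> c x y; rewrite /starin_fun linearP dsumP !linearP.
by congr (_, _); exact: add00.
Qed.
HB.instance Definition _ a :=
  GRing.isLinear.Build K Mbar Mbar *:%R (starin_fun a) (starin_linear a).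
Definition starin (a : inar Q k) : endo Mbar := to_endo (starin_fun a).

(* The projection of M onto M_h(b), followed by the inclusion into Mout. *)
Definition injout (b : outar Q k) (m : kmod M) : Mout M k := fun b' =>
  if b' == b then to_Mv M (hd (val b')) m else 0.
Fact injout_linear b : linear (injout b).
Proof.
move=> c x y; apply: functional_extensionality_dep => b'.
rewrite dsumP /injout; case: (b' == b); first exact: linearP.
exact: add00.
Qed.
HB.instance Definition _ b :=
  GRing.isLinear.Build K (kmod M) (Mout M k) *:%R (injout b) (injout_linear b).

(* b^* : M_h(b) -> Mbar_k is the component of alphabar at b. *)
Definition starout_fun (b : outar Q k) (x : Mbar) : Mbar :=
  (0, alphabar d (injout b (iota_Mhat M k x.1))).
Fact starout_linear b : linear (starout_fun b).
Proof.
move=> c x y; rewrite /starout_fun !linearP.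
by congr (_, _); exact: add00.
Qed.
HB.instance Definition _ b :=
  GRing.isLinear.Build K Mbar Mbar *:%R (starout_fun b) (starout_linear b).
Definition starout (b : outar Q k) : endo Mbar := to_endo (starout_fun b).

Definition eta_arrow (c : Q1) : endo Mbar :=
  match c with
  | Plain c => theta (rhotilde (arr (val c)))
  | Comp b a => theta (rhotilde (arr (val b) * arr (val a)))
  | StarIn a => starin a
  | StarOut b => starout b
  end.
Definition eta_path (p : qpath Q1) : endo Mbar :=
  idembar (ph p) * \prod_(c <- ps p) eta_arrow c.

(* The action of the path algebra: the sum is over the support of u. *)
Definition eta (u : cpa K Q1) : endo Mbar :=
  \sum_(p \in classical_sets.setT) u p *: eta_path p.

Definition Theta (u : cpa K Q1) : endo Mbar :=
  theta (rhotilde (psi S (kappa u))).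

Definition eta_tilde (u : cpa K Q1) : endo Mbar :=
  eta (compz u *: idem k) + Theta (comphat u)
  + \sum_(a : inar Q k) Theta (compv u a) * eta (arr (StarIn a : Q1))
  + \sum_(b : outar Q k) eta (arr (StarOut b : Q1)) * Theta (compw u b)
  + \sum_(a : inar Q k) \sum_(b : outar Q k)
      eta (arr (StarOut b : Q1)) * Theta (compx u a b) * eta (arr (StarIn a : Q1)).

(* K^{Q_0}-ring homomorphisms to End_K(Mbar). *)
Definition vring_hom (F : cpa K Q1 -> endo Mbar) : Prop :=
  [/\ linear F, monoid_morphism F & forall j, F (idem j) = idembar j].

Definition extends_eta_Theta (F : cpa K Q1 -> endo Mbar) : Prop :=
  (forall u, in_path_algebra u -> F u = eta u) /\
  (forall u, F (idemhat K Q1 k * u * idemhat K Q1 k) =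
             Theta (idemhat K Q1 k * u * idemhat K Q1 k)).
End Mutation.

Definition locally_nilpotent (K : fieldType) (I : finType) (Q : quiver I)
    (N : lmodType K) (F : cpa K Q -> N -> N) : Prop :=
  forall x, exists n, forall u, idealpow arrow_ideal n u -> F u x = 0.

Definition nilpotent (K : fieldType) (I : finType) (Q : quiver I)
    (N : lmodType K) (F : cpa K Q -> N -> N) : Prop :=
  exists n, forall u, idealpow arrow_ideal n u -> forall x, F u x = 0.

Definition not_in_two_cycle (I : finType) (Q : quiver I) (k : I) : Prop :=
  forall a b : Q, hd a = tl b -> hd b = tl a -> hd a != k /\ tl a != k.

(* Main.v *)
Require Import Defs.
From HB Require Import structures.
From mathcomp Require Import all_boot all_algebra.
From mathcomp Require Import boolp classical_sets cardinality fsbigop.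

(* Write e for the sum of the e_j with j <> k. Every u in A = K<<mu_k Q>> is
   z e_k plus a finite sum of blocks l x r with x in eAe, where l is e or some
   b^* and r is e or some a^*. On a block eta~ takes the value
   eta(l) Theta(x) eta(r), and the product of two blocks is again a block,
   (l x r)(l' x' r') = l (x (r l') x') r' with r l' in eAe. Multiplicativity of
   eta~ therefore reduces to that of Theta on eAe together with
   Theta(r l') = eta(r) eta(l'). The only case of the latter with content is
   Theta [a^* b^*] = eta [a^*] eta [b^*], which holds because both sides are
   - d_(ba)(S)_M: for the right-hand side this is betabar alphabar = - gamma.
   Theta is multiplicative on eAe because psi is continuous; here one needs
   d_(ba)(S) in the arrow ideal, which is where the absence of 2-cycles at k
   enters. The same decomposition gives uniqueness, and nilpotency follows since
   psi kappa at worst halves the order of a series. *)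

(** [M] is not assumed nilpotent, so the values of [eta] on the paths of an infinite series cannot
    be summed in End_K(Mbar), and [eta_tilde] is not obtained from [eta] by continuity. Infinite
    series act only because [M] is a module over the complete algebra P(Q,S); every limit is
    therefore taken on the side of [Q], inside [psi], before acting on [M]. This is available only
    away from k. The decomposition confines what happens at k to finitely many starred factors,
    since finitely many arrows meet k, and loop-freeness keeps the other ends of these arrows off k.
    The identity betabar alphabar = - gamma has to be checked in each description of Mbar_k. In B,
    gamma takes values in ker alpha because alpha gamma = 0; in C, gamma passes to coker beta
    because gamma beta = 0. Both vanishings come from d_b(S) = sum_a a d_(ba)(S) and d_a(S) = sum_b
    d_(ba)(S) b, for a ending and b starting at k, because the left-hand sides act as zero on
    [M]. *)

Set Implicit Arguments.
Unset Strict Implicit.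
Unset Printing Implicit Defensive.

Import GRing.Theory.
Local Open Scope ring_scope.

(** * Coefficients, division by arrows and powers of the arrow ideal *)

Section Coefficients.
Variables (K : fieldType) (I : finType) (Q : quiver I).
Implicit Types (u v : cpa K Q) (i j : I) (s : seq Q) (c : Q) (p q : qpath Q).

Lemma path_coefE u p : coef u (ph p) (ps p) = u p.
Proof.
rewrite /coef; have -> : (ph p, ps p) = val p by rewrite /ph /ps; case: (val p).
by rewrite valK.
Qed.

Lemma coef_insub u i s (h : pathb i s) : coef u i s = u (@QPath _ _ (i, s) h).
Proof. by rewrite -path_coefE. Qed.

Lemma coef_nonpath u i s : ~~ pathb i s -> coef u i s = 0.
Proof. by move=> h; rewrite /coef insubF //; apply: negbTE. Qed.

(** Series are compared at all pairs [(i, s)], paths or not: [coef] is 0 off paths, so no proof of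
    composability has to be carried along when words are cut or concatenated. *)
Lemma path_coefP u v : (forall i s, coef u i s = coef v i s) -> u = v.
Proof. by move=> uv; apply: cpaE => p; rewrite -!path_coefE. Qed.

(** Because [coef] vanishes off paths, a formula in the head and the word computes it only if the
    formula vanishes there as well; hence the side condition. *)
Lemma coef_fun (f : I -> seq Q -> K) i s : (~~ pathb i s -> f i s = 0) ->
  coef (fun p => f (ph p) (ps p) : K) i s = f i s.
Proof.
by move=> f0; case/boolP: (pathb i s) => [h|/[dup] h /f0 ->];
  [rewrite (coef_insub _ h)|rewrite coef_nonpath].
Qed.

Lemma path_coef0 i s : coef (0 : cpa K Q) i s = 0.
Proof. by rewrite /coef; case: insub. Qed.
Lemma path_coefD u v i s : coef (u + v) i s = coef u i s + coef v i s.
Proof. by rewrite /coef; case: insub => //=; rewrite addr0. Qed.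
Lemma path_coefZ a u i s : coef (a *: u) i s = a * coef u i s.
Proof. by rewrite /coef; case: insub => //=; rewrite mulr0. Qed.
Lemma path_coefN u i s : coef (- u) i s = - coef u i s.
Proof. by rewrite -scaleN1r path_coefZ mulN1r. Qed.
Lemma path_coefB u v i s : coef (u - v) i s = coef u i s - coef v i s.
Proof. by rewrite path_coefD path_coefN. Qed.
Lemma path_coef_sum (J : Type) (r : seq J) (P : pred J) (F : J -> cpa K Q) i s :
  coef (\sum_(x <- r | P x) F x) i s = \sum_(x <- r | P x) coef (F x) i s.
Proof.
by apply: (big_morph (fun u => coef u i s)) => [u v|]; rewrite ?path_coefD ?path_coef0.
Qed.

Lemma path_coefM u v i s : coef (u * v) i s =
  \sum_(n < (size s).+1) coef u i (take n s) * coef v (stail i (take n s)) (drop n s).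
Proof.
case/boolP: (pathb i s) => [h|nh].
  rewrite (coef_insub _ h) cpaM; apply: eq_bigr => n _.
  by rewrite -!path_coefE.
rewrite coef_nonpath // big1 // => n _.
have: ~~ (pathb i (take n s) && pathb (stail i (take n s)) (drop n s)).
  by rewrite -pathb_cat cat_take_drop.
by case/nandP => /coef_nonpath ->; rewrite ?mul0r ?mulr0.
Qed.

Lemma coef_pathelt x i s :
  coef (pathelt K x : cpa K Q) i s = (pathb i s && ((i, s) == x))%:R.
Proof.
by case/boolP: (pathb i s) => h; [rewrite (coef_insub _ h)|rewrite coef_nonpath].
Qed.

Lemma coef_idem j i s : coef (idem j : cpa K Q) i s = ((i == j) && (s == [::]))%:R.
Proof.
rewrite coef_pathelt xpair_eqE.
by case: s => [|c s] //=; rewrite !andbF.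
Qed.

Lemma path_coef1 i s : coef (1 : cpa K Q) i s = (s == [::])%:R.
Proof.
case/boolP: (pathb i s) => [h|]; first by rewrite (coef_insub _ h) -size_eq0.
by case: s => // c s h; rewrite coef_nonpath.
Qed.

Lemma sum_idem : \sum_j idem j = 1 :> cpa K Q.
Proof.
apply: path_coefP => i s; rewrite path_coef_sum path_coef1 (bigD1 i) //= coef_idem eqxx /=.
by rewrite big1 ?addr0 // => j ji; rewrite coef_idem eq_sym (negbTE ji).
Qed.

Lemma coef_idemM j u i s : coef (idem j * u) i s = (i == j)%:R * coef u i s.
Proof.
rewrite path_coefM big_ord_recl /= take0 drop0 coef_idem eqxx andbT.
rewrite big1 ?addr0 // => n _; rewrite coef_idem.
by case: s n => [[]|c s n] //=; rewrite andbF mul0r.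
Qed.

Lemma coef_Midem j u i s : coef (u * idem j) i s = coef u i s * (stail i s == j)%:R.
Proof.
rewrite path_coefM big_ord_recr /= take_size drop_size coef_idem eqxx andbT.
rewrite big1 ?add0r // => n _; rewrite coef_idem.
by rewrite -size_eq0 size_drop subn_eq0 leqNgt ltn_ord andbF mulr0.
Qed.

Lemma coef_arrM c u i s : coef (arr c * u) i s =
  if s is c' :: s' then ((c' == c) && (i == hd c))%:R * coef u (tl c) s' else 0.
Proof.
case: s => [|c' s].
  by rewrite path_coefM big_ord1 /= coef_pathelt xpair_eqE andbF mul0r.
rewrite path_coefM !big_ord_recl /= !take0 drop0 coef_pathelt xpair_eqE andbF mul0r.
rewrite add0r coef_pathelt /= xpair_eqE eqseq_cons eqxx !andbT.
rewrite big1 ?addr0 => [|n _].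
  case: (c' =P c) => [->|_]; last by rewrite !andbF !mul0r.
  by rewrite andbT andTb eq_sym andbb.
rewrite coef_pathelt /= xpair_eqE eqseq_cons.
by case: s n => [[]|c'' s n] //=; rewrite !andbF mul0r.
Qed.

Lemma coef_Marr_nil c u i : coef (u * arr c) i [::] = 0.
Proof.
by rewrite path_coefM big_ord1 /= coef_pathelt xpair_eqE andbF mulr0.
Qed.

Lemma coef_Marr c u i s c' : coef (u * arr c) i (rcons s c') =
  ((c' == c) && (stail i s == hd c))%:R * coef u i s.
Proof.
rewrite path_coefM size_rcons !big_ord_recr /=.
have E0 j : coef (arr c) j [::] = 0 :> K by rewrite coef_pathelt xpair_eqE andbF.
rewrite -{3}(size_rcons s c') drop_size E0 mulr0 addr0 -cats1 take_size_cat // drop_size_cat //.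
rewrite coef_pathelt xpair_eqE eqseq_cons eqxx !andbT /=.
rewrite big1 ?add0r => [|n _].
  rewrite mulrC; congr (_%:R * _).
  by case: (c' =P c) => [->|_]; rewrite ?andbF // !andbT andTb eq_sym andbb.
rewrite coef_pathelt xpair_eqE drop_cat ltn_ord.
have := size_drop n s; case: (drop n s) => [|a [|b t]] /=.
- by move=> h; have := ltn_ord n; rewrite -subn_gt0 -h.
- by rewrite eqseq_cons andbF andbF andbF mulr0.
by rewrite eqseq_cons !andbF mulr0.
Qed.

(** Removal of a leading, resp. final, arrow [c] from the paths that have one. Up to an idempotent
    these invert multiplication by [arr c] ([ldiv_arrM], [rdiv_Marr]). They carry both the relation
    between [cder] and [cder2] and the components of a series of the premutated algebra. *)
Definition ldiv c u : cpa K Q := fun p =>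
  if ph p == tl c then coef u (hd c) (c :: ps p) else 0.
Definition rdiv c u : cpa K Q := fun p =>
  if stail (ph p) (ps p) == hd c then coef u (ph p) (rcons (ps p) c) else 0.

Lemma pathb_rcons i s c : pathb i (rcons s c) = pathb i s && (hd c == stail i s).
Proof. by rewrite -cats1 pathb_cat /= andbT. Qed.

Lemma coef_ldiv c u i s :
  coef (ldiv c u) i s = (i == tl c)%:R * coef u (hd c) (c :: s).
Proof.
rewrite (coef_fun (f := fun i s => if i == tl c then coef u (hd c) (c :: s) else 0)).
  by case: eqP; rewrite ?mul1r ?mul0r.
case: eqP => // -> ns; rewrite coef_nonpath //=.
by rewrite eqxx.
Qed.

(** No guard survives: if [s] does not end where [c] begins, [rcons s c] is not a path and its
    coefficient is already 0. In [coef_ldiv] the head [i] is absent from the coefficient on the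
    right and has to be tested. *)
Lemma coef_rdiv c u i s : coef (rdiv c u) i s = coef u i (rcons s c).
Proof.
have E : coef u i (rcons s c) =
    if stail i s == hd c then coef u i (rcons s c) else 0.
  case: eqP => // /eqP ne; apply: coef_nonpath.
  by rewrite pathb_rcons eq_sym (negbTE ne) andbF.
rewrite E (coef_fun (f := fun i s => if stail i s == hd c
  then coef u i (rcons s c) else 0)) //.
by case: eqP => // _ ns; rewrite coef_nonpath // pathb_rcons (negbTE ns).
Qed.

Lemma stail_rcons i s c : stail i (rcons s c) = tl c.
Proof. by rewrite /stail map_rcons last_rcons. Qed.

Lemma idemM i j : idem i * idem j = (if i == j then idem i else 0) :> cpa K Q.
Proof.
apply: path_coefP => i' s; rewrite coef_idemM (fun_if (fun u => coef u i' s)).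
rewrite !coef_idem path_coef0.
case: (i' =P i) => [->|_]; rewrite ?mul0r ?mul1r ?if_same //.
by case: ifP.
Qed.

Lemma idem_arr c : idem (hd c) * arr c = arr c :> cpa K Q.
Proof.
apply: path_coefP => i s; rewrite coef_idemM coef_pathelt xpair_eqE.
by case: eqP; rewrite ?mul1r ?andbF ?mul0r.
Qed.

Lemma arr_idem c : arr c * idem (tl c) = arr c :> cpa K Q.
Proof.
apply: path_coefP => i s; rewrite coef_Midem coef_pathelt xpair_eqE.
by case: (s =P [:: c]) => [->|_]; rewrite ?andbF ?mul0r // eqxx mulr1.
Qed.

Lemma cpa_scale1Z (a : K) u : (a *: (1 : cpa K Q)) * u = a *: u.
Proof. by rewrite -cpa_scaleAl mul1r. Qed.

Lemma pathelt_cons i c s : pathb i (c :: s) ->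
  pathelt K (i, c :: s) = arr c * pathelt K (tl c, s) :> cpa K Q.
Proof.
move=> /andP[/eqP <- cs]; apply: path_coefP => j s'.
rewrite coef_arrM coef_pathelt; case: s' => [|c' s'] //.
  by rewrite xpair_eqE andbF.
rewrite coef_pathelt /= !xpair_eqE eqseq_cons eqxx /=.
case: (c' =P c) => [->|_]; last by rewrite !andbF mul0r.
rewrite eq_sym; case: (j == hd c); last by rewrite mul0r.
by rewrite mul1r.
Qed.

Definition order_ge n u := forall p, (plen p < n)%N -> u p = 0.

Lemma order_ge_coef n u :
  order_ge n u <-> (forall i s, (size s < n)%N -> coef u i s = 0).
Proof.
split=> [h i s sn|h p pn]; last by rewrite -path_coefE h.
by case/boolP: (pathb i s) => [hp|/coef_nonpath ->//]; rewrite (coef_insub _ hp) h.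
Qed.

Lemma order_geD n u v : order_ge n u -> order_ge n v -> order_ge n (u + v).
Proof. by move=> hu hv p pn; rewrite cpaD hu // hv // addr0. Qed.
Lemma order_ge_sum (J : Type) (r : seq J) (P : pred J) (F : J -> cpa K Q) n :
  (forall x, P x -> order_ge n (F x)) -> order_ge n (\sum_(x <- r | P x) F x).
Proof. by move=> hF; apply: big_ind; [|exact: order_geD|]. Qed.
Lemma order_ge_leq m n u : (m <= n)%N -> order_ge n u -> order_ge m u.
Proof. by move=> mn h p pm; apply: h; apply: leq_trans mn. Qed.

Lemma order_geM m n u v : order_ge m u -> order_ge n v -> order_ge (m + n) (u * v).
Proof.
move=> hu hv p pmn; rewrite cpaM big1 // => l _.
case: (ltnP l m) => lm.
  by rewrite hu ?mul0r // plen_take // -ltnS.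
rewrite hv ?mulr0 // plen_drop ltn_subLR; last by rewrite -ltnS.
by apply: leq_trans pmn _; rewrite leq_add2r.
Qed.

Lemma order_ge_arr c : order_ge 1 (arr c).
Proof.
apply/order_ge_coef => i [|//] _; by rewrite coef_pathelt xpair_eqE andbF.
Qed.

Lemma sum_arr_ldiv u : order_ge 1 u -> u = \sum_c arr c * ldiv c u.
Proof.
move=> /order_ge_coef hu; apply: path_coefP => i s; rewrite path_coef_sum.
case: s => [|c s]; first by rewrite hu // big1 // => c _; rewrite coef_arrM.
rewrite (bigD1 c) //= big1 => [|c' c'c].
  rewrite coef_arrM coef_ldiv !eqxx addr0 mul1r andTb.
  case: eqP => [->|/eqP ne]; first by rewrite mul1r.
  by rewrite mul0r coef_nonpath //= eq_sym (negbTE ne).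
by rewrite coef_arrM eq_sym (negbTE c'c) mul0r.
Qed.

(** The quiver has finitely many arrows, so removing the first arrow writes a series of order at
    least n+1 as a finite sum of products of an arrow and a series of order at least n. Powers of
    the algebraically generated ideal are thus already closed, and the m-adic topology is read off
    from lengths of paths. *)
Lemma idealpowE n u : idealpow arrow_ideal n u <-> order_ge n u.
Proof.
split=> [|].
  elim: n u => [|n IH] u //= [s sP ->]; rewrite big_seq.
  apply: order_ge_sum => x /sP[[t tP ->] /IH hx]; rewrite -add1n.
  apply: order_geM => //; rewrite big_seq; apply: order_ge_sum => y /tP /= [c _ <-].
  by rewrite -[1%N]addn0; apply: order_geM => //; rewrite -[1%N]add0n;
    apply: order_geM => //; apply: order_ge_arr.
elim: n u => [|n IH] u hu //=.
exists [seq (arr c, ldiv c u) | c <- enum Q]; last first.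
  rewrite big_map /= enumT; apply: sum_arr_ldiv; exact: order_ge_leq hu.
move=> x /mapP[c _ ->] /=; split.
  exists [:: (1, arr c, 1)]; last by rewrite big_seq1 mul1r mulr1.
  by move=> y; rewrite inE => /eqP -> /=; exists c.
apply/IH/order_ge_coef => i s sn; rewrite coef_ldiv.
by move/order_ge_coef: hu => ->; rewrite ?mulr0.
Qed.

End Coefficients.

(** * Continuous extension of maps given on paths *)

Lemma fsbig_seqT (V : zmodType) (T : choiceType) (r : seq T) (F : T -> V) :
  uniq r -> (forall x, x \notin r -> F x = 0) ->
  \sum_(x \in [set: T]%classic) F x = \sum_(x <- r) F x.
Proof.
move=> r_uniq F0; rewrite (fsbigE r) // => [|x _]; last exact: F0.
by apply: eq_bigl => x; rewrite in_setT.
Qed.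

Section Truncation.
Variables (K : fieldType) (I : finType) (Q : quiver I).
Implicit Types (u : cpa K Q) (p q : qpath Q).

(** Heads and words are enumerated regardless of composability, [insub] keeps the paths, and [undup]
    gives uniqueness without any injectivity argument. *)
Definition paths (n : nat) : seq (qpath Q) :=
  undup (pmap insub [seq (i, s) | i <- enum I,
    s <- flatten [seq map val (enum {: m.-tuple Q}) | m <- iota 0 n]]).

Lemma mem_paths n p : (p \in paths n) = (plen p < n)%N.
Proof.
rewrite mem_undup mem_pmap_sub; apply/allpairsP/idP => [[[i s] [_ /=]]|pn].
  move=> /flatten_mapP[m]; rewrite mem_iota add0n /= => mn /mapP[t _ ->] E.
  by rewrite /plen /ps /= E /= size_tuple.
exists (val p); split; first by rewrite mem_enum.
  apply/flatten_mapP; exists (plen p); first by rewrite mem_iota.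
  by apply/mapP; exists (in_tuple (ps p)); rewrite ?mem_enum.
by case: (val p).
Qed.

Lemma paths_uniq n : uniq (paths n). Proof. exact: undup_uniq. Qed.

Definition trunc n u : cpa K Q := \sum_(q <- paths n) u q *: pathelt K (val q).

Lemma cpa_sum (J : Type) (r : seq J) (P : pred J) (F : J -> cpa K Q) p :
  (\sum_(x <- r | P x) F x) p = \sum_(x <- r | P x) F x p.
Proof. exact: (big_morph (fun u : cpa K Q => u p)). Qed.

Lemma trunc_order n u : order_ge n (u - trunc n u).
Proof.
move=> p pn; have -> : (u - trunc n u) p = u p - trunc n u p by [].
rewrite /trunc cpa_sum (bigD1_seq p) ?paths_uniq ?mem_paths //= cpaZ /pathelt eqxx mulr1.
rewrite big1 ?addr0 ?subrr // => q qp; rewrite cpaZ eq_sym.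
by rewrite (inj_eq val_inj) (negbTE qp) mulr0.
Qed.

End Truncation.

Section Extension.
Variables (K : fieldType) (I J : finType) (Q : quiver I) (Q' : quiver J).
Variable f : qpath Q -> cpa K Q'.
Implicit Types (u v : cpa K Q).

Lemma linext_pathelt q : linext f (pathelt K (val q)) = f q.
Proof.
apply: cpaE => p; rewrite /linext (@fsbig_seqT _ _ [:: q]) //=.
  by rewrite big_seq1 /pathelt eqxx mul1r.
by move=> q'; rewrite inE /pathelt (inj_eq val_inj) => /negbTE ->; rewrite mul0r.
Qed.

Hypothesis f_order : forall q, order_ge (plen q) (f q).

(** Paths of length at least n contribute nothing at [p], since [f q] has order at least the length
    of [q]. The sum in [linext] is thus finite at each coefficient; over an infinite support it
    would be 0 by convention, and additivity could fail. *)
Lemma linextE n u p : (plen p < n)%N -> linext f u p = \sum_(q <- paths Q n) u q * f q p.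
Proof.
move=> pn; rewrite /linext (@fsbig_seqT _ _ (paths Q n)) ?paths_uniq // => q.
by rewrite mem_paths -leqNgt => nq; rewrite f_order ?mulr0 //; apply: leq_trans nq.
Qed.

Lemma linextP a u v : linext f (a *: u + v) = a *: linext f u + linext f v.
Proof.
apply: cpaE => p; rewrite cpaD cpaZ !(linextE _ (ltnSn _)) mulr_sumr -big_split.
by apply: eq_bigr => q _; rewrite cpaD cpaZ mulrDl mulrA.
Qed.

Lemma linext0 : linext f 0 = 0.
Proof.
have := linextP 1 0 0; rewrite !scale1r addr0.
by move/(congr1 (fun w => w - linext f 0)); rewrite subrr addrK.
Qed.

Lemma linextD u v : linext f (u + v) = linext f u + linext f v.
Proof. by have := linextP 1 u v; rewrite !scale1r. Qed.

Lemma linextZ a u : linext f (a *: u) = a *: linext f u.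
Proof. by rewrite -[a *: u]addr0 linextP linext0 addr0. Qed.

Lemma linext_sum (T : Type) (r : seq T) (P : pred T) (F : T -> cpa K Q) :
  linext f (\sum_(x <- r | P x) F x) = \sum_(x <- r | P x) linext f (F x).
Proof. exact: (big_morph _ linextD linext0). Qed.

Lemma linext_order n u : order_ge n u -> order_ge n (linext f u).
Proof.
move=> hu p pn; rewrite (linextE _ (ltnSn _)) big_seq big1 // => q.
rewrite (mem_paths (plen p).+1 q) ltnS => qp; by rewrite hu ?mul0r // (leq_ltn_trans qp).
Qed.

(* Both sides are continuous and bilinear, so it suffices to compare them on
   truncations. *)
Lemma linextM :
  (forall q q', linext f (pathelt K (val q) * pathelt K (val q')) = f q * f q') ->
  forall u v, linext f (u * v) = linext f u * linext f v.
Proof.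
move=> fM u v; apply: cpaE => p; set n := (plen p).+1.
have tr (w : cpa K Q) : w = trunc n w + (w - trunc n w) by rewrite addrC subrK.
have high w : order_ge n w -> linext f w p = 0.
  by move=> hw; apply: linext_order hw _ _.
have trM : linext f (trunc n u * trunc n v) = linext f (trunc n u) * linext f (trunc n v).
  rewrite /trunc mulr_suml !linext_sum mulr_suml; apply: eq_bigr => q _.
  rewrite mulr_sumr mulr_sumr linext_sum; apply: eq_bigr => q' _.
  by rewrite -cpa_scaleAl -cpa_scaleAr !linextZ fM !linext_pathelt
    -cpa_scaleAl -cpa_scaleAr.
have := @trunc_order _ _ _ n u; have := @trunc_order _ _ _ n v.
move: (tr u) (tr v); move: (u - _) (v - _) => u' v' Eu Ev hv hu.
rewrite [in LHS]Eu [in LHS]Ev [in RHS]Eu [in RHS]Ev.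
rewrite !mulrDl !mulrDr !linextD !mulrDl !mulrDr trM !cpaD.
have ordMl J' (Q0 : quiver J') (a b : cpa K Q0) : order_ge n a -> order_ge n (a * b).
  by move=> h; rewrite -[n]addn0; apply: order_geM.
have ordMr J' (Q0 : quiver J') (a b : cpa K Q0) : order_ge n b -> order_ge n (a * b).
  by move=> h; rewrite -[n]add0n; apply: order_geM.
have fu' : order_ge n (linext f u') by apply: linext_order.
have fv' : order_ge n (linext f v') by apply: linext_order.
rewrite (high (trunc n u * v')) ?(high (u' * trunc n v)) ?(high (u' * v'));
  [|exact: ordMl|exact: ordMl|exact: ordMr].
by rewrite !(ordMl _ _ _ _ fu') // (ordMr _ _ _ _ fv').
Qed.

End Extension.

(** * Cyclic derivatives *)

Lemma sum_codom (V : nmodType) (T T' : finType) (h : T -> T') (F : T' -> V) :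
  injective h -> (forall x, x \notin codom h -> F x = 0) ->
  \sum_x F x = \sum_t F (h t).
Proof.
move=> h_inj F0; have h_uniq : uniq (codom h) by rewrite map_inj_uniq ?enum_uniq.
transitivity (\sum_(x in codom h) F x).
  rewrite [RHS]big_mkcond /=; apply: eq_bigr => x _.
  by case: ifP => // /negbT /F0.
by rewrite -big_uniq //= big_image.
Qed.

Section Divisions.
Variables (K : fieldType) (I : finType) (Q : quiver I).
Implicit Types (u : cpa K Q) (j : I) (c : Q).

Lemma sum_arr_rdiv u : order_ge 1 u -> u = \sum_c rdiv c u * arr c.
Proof.
move=> /order_ge_coef hu; apply: path_coefP => i s; rewrite path_coef_sum.
case/lastP: s => [|s c]; first by rewrite hu // big1 // => c _; rewrite coef_Marr_nil.
rewrite (bigD1 c) //= big1 => [|c' c'c]; last first.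
  by rewrite coef_Marr eq_sym (negbTE c'c) mul0r.
rewrite coef_Marr coef_rdiv eqxx addr0 andTb.
case: eqP => [_|/eqP ne]; first by rewrite mul1r.
by rewrite mul0r coef_nonpath // pathb_rcons eq_sym (negbTE ne) andbF.
Qed.

(** When all paths of [u] have head j, only the arrows with head j can come first; [h] is any
    injective list containing them, such as [val] on a subtype or a constructor of starred
    arrows. *)
Lemma sum_arr_ldiv_at (T : finType) (h : T -> Q) j u : injective h ->
  (forall c, hd c = j -> c \in codom h) -> order_ge 1 u -> idem j * u = u ->
  u = \sum_t arr (h t) * ldiv (h t) u.
Proof.
move=> h_inj hP u1 uj; rewrite {1}(sum_arr_ldiv u1); apply: sum_codom => // c hc.
have cj : hd c != j by apply: contra hc => /eqP /hP.
suff -> : ldiv c u = 0 by rewrite mulr0.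
by apply: path_coefP => i s; rewrite path_coef0 coef_ldiv -uj coef_idemM (negbTE cj) mul0r mulr0.
Qed.

Lemma sum_arr_rdiv_at (T : finType) (h : T -> Q) j u : injective h ->
  (forall c, tl c = j -> c \in codom h) -> order_ge 1 u -> u * idem j = u ->
  u = \sum_t rdiv (h t) u * arr (h t).
Proof.
move=> h_inj hP u1 uj; rewrite {1}(sum_arr_rdiv u1); apply: sum_codom => // c hc.
have cj : tl c != j by apply: contra hc => /eqP /hP.
suff -> : rdiv c u = 0 by rewrite mul0r.
apply: path_coefP => i s; rewrite path_coef0 coef_rdiv -uj coef_Midem stail_rcons.
by rewrite (negbTE cj) mulr0.
Qed.
End Divisions.

Section CyclicDerivatives.
Variables (K : fieldType) (I : finType) (Q : quiver I) (S : cpa K Q).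
Hypotheses (Q_loop_free : loop_free Q) (S_potential : potential S).
Implicit Types (a b : Q) (c : qpath Q).

(** Identities between derivatives are then checked term by term in this sum, one cyclic path of [S]
    at a time. *)
Lemma coef_linext (J : finType) (Q' : quiver J) (f : qpath Q -> cpa K Q') (u : cpa K Q) i s :
  coef (linext f u) i s = \sum_(q \in [set: qpath Q]%classic) u q * coef (f q) i s.
Proof.
case/boolP: (pathb i s) => h.
  by rewrite (coef_insub _ h); apply: eq_fsbigr => q _; rewrite (coef_insub _ h).
rewrite coef_nonpath // fsbig1 // => q _; by rewrite coef_nonpath // mulr0.
Qed.

Definition composable a b := tl a == hd b.

Lemma pathb_composable i a s : pathb i (a :: s) = (hd a == i) && path composable a s.
Proof.
elim: s a i => [|b s IH] a i //.
rewrite -[LHS]/((hd a == i) && pathb (tl a) (b :: s)) IH /=.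
by rewrite /composable [hd b == _]eq_sym.
Qed.

(** The predicate [cycle composable] is invariant under rotation; this is how every rotation of a
    path in the support of [S] is known to be a path again. *)
Lemma potential_cycle c : S c != 0 -> cycle composable (ps c).
Proof.
move=> /S_potential; rewrite /plen /pt; have := qpathP c.
case: (ps c) => // a s; rewrite pathb_composable => /andP[/eqP ha sP] [_].
rewrite /= rcons_path sP /= /stail /= last_map => E.
by rewrite /composable -E ha.
Qed.

Lemma rot_potential c n a s : S c != 0 -> rot n (ps c) = a :: s ->
  pathb (tl a) s /\ stail (tl a) s = hd a.
Proof.
move=> /potential_cycle; rewrite -(rot_cycle n) => + E; rewrite E /= rcons_path.
case/andP=> sP /eqP <-; split; last by rewrite /stail last_map.
by have := pathb_composable (hd a) a s; rewrite /= eqxx sP.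
Qed.

(** On the support of [S] what remains after removing [a] is a genuine path, so [pathelt] does not
    default to 0 and the coefficient counts rotations. *)
Lemma coef_dpath a c i s : S c != 0 ->
  coef (dpath K a c) i s =
  \sum_(n < plen c) ((i == tl a) && (rot n (ps c) == a :: s))%:R.
Proof.
move=> Sc; rewrite path_coef_sum; apply: eq_bigr => n _.
case E : (rot n (ps c)) => [|a' t]; first by rewrite path_coef0 andbF.
rewrite eqseq_cons; case: (a' =P a) E => [->|_] E; last by rewrite path_coef0 andbF.
rewrite coef_pathelt xpair_eqE /= [t == s]eq_sym.
case: (i =P tl a) => [->|]; case: (s =P t) => [->|]; rewrite ?andbF //.
by have [-> _] := rot_potential Sc E.
Qed.

Lemma coef_d2path b a c i s : S c != 0 ->
  coef (d2path K b a c) i s =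
  \sum_(n < plen c) ((i == tl a) && (rot n (ps c) == [:: b, a & s]))%:R.
Proof.
move=> Sc; rewrite path_coef_sum; apply: eq_bigr => n _.
case E : (rot n (ps c)) => [|b' [|a' t]]; rewrite ?path_coef0 ?eqseq_cons ?andbF //.
case: (b' =P b) E => [->|_] E; last by rewrite path_coef0 andbF.
case: (a' =P a) E => [->|_] E; last by rewrite path_coef0 !andbF.
rewrite coef_pathelt xpair_eqE /= [t == s]eq_sym.
case: (i =P tl a) => [->|]; case: (s =P t) => [->|]; rewrite ?andbF //.
by have [/andP[_ tP] _] := rot_potential Sc E; rewrite -/(pathb _ _) in tP; rewrite tP.
Qed.

Lemma coef_cder_eq0 a i s :
  (forall n c, S c != 0 -> i = tl a -> rot n (ps c) = a :: s -> False) ->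
  coef (cder a S) i s = 0.
Proof.
move=> h; rewrite coef_linext fsbig1 // => c _.
have [->|Sc] := eqVneq (S c) 0; first by rewrite mul0r.
rewrite coef_dpath // big1 ?mulr0 // => n _.
by case: eqP => // Ei; case: eqP => // /(h _ _ Sc Ei).
Qed.

Lemma coef_cder2_eq0 b a i s :
  (forall n c, S c != 0 -> i = tl a -> rot n (ps c) = [:: b, a & s] -> False) ->
  coef (cder2 b a S) i s = 0.
Proof.
move=> h; rewrite coef_linext fsbig1 // => c _.
have [->|Sc] := eqVneq (S c) 0; first by rewrite mul0r.
rewrite coef_d2path // big1 ?mulr0 // => n _.
by case: eqP => // Ei; case: eqP => // /(h _ _ Sc Ei).
Qed.

(** A constant term would come from the cyclic path [a] of length 1, that is, from a loop. *)
Lemma order_ge_cder a : order_ge 1 (cder a S).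
Proof.
apply/order_ge_coef => i [|//] _; apply: coef_cder_eq0 => n c Sc _ E.
by have [_ /eqP] := rot_potential Sc E; rewrite eq_sym (negbTE (Q_loop_free a)).
Qed.

Lemma idem_cder a : idem (tl a) * cder a S = cder a S.
Proof.
apply: path_coefP => i s; rewrite coef_idemM; case: eqP => [_|ne]; first by rewrite mul1r.
by rewrite mul0r coef_cder_eq0.
Qed.

Lemma cder_idem a : cder a S * idem (hd a) = cder a S.
Proof.
apply: path_coefP => i s; rewrite coef_Midem; case: eqP => [_|ne]; first by rewrite mulr1.
rewrite mulr0 coef_cder_eq0 // => n c Sc Ei E; apply: ne.
by rewrite Ei; case: (rot_potential Sc E).
Qed.

Lemma idem_cder2 b a : idem (tl a) * cder2 b a S = cder2 b a S.
Proof.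
apply: path_coefP => i s; rewrite coef_idemM; case: eqP => [_|ne]; first by rewrite mul1r.
by rewrite mul0r coef_cder2_eq0.
Qed.

Lemma cder2_idem b a : cder2 b a S * idem (hd b) = cder2 b a S.
Proof.
apply: path_coefP => i s; rewrite coef_Midem; case: eqP => [_|ne]; first by rewrite mulr1.
rewrite mulr0 coef_cder2_eq0 // => n c Sc Ei E; apply: ne.
by rewrite Ei; case: (rot_potential Sc E).
Qed.

(** A constant term would come from the cyclic path [b a] of length 2. *)
Lemma order_ge_cder2 b a : tl a != hd b -> order_ge 1 (cder2 b a S).
Proof.
move=> ab; apply/order_ge_coef => i [|//] _; apply: coef_cder2_eq0 => n c Sc _ E.
by have [_ /= /eqP] := rot_potential Sc E; rewrite (negbTE ab).
Qed.

Lemma ldiv_cder a b : tl b = hd a -> ldiv a (cder b S) = cder2 b a S.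
Proof.
move=> ba; apply: path_coefP => i s; rewrite coef_ldiv !coef_linext mulr_fsumr.
apply: eq_fsbigr => c _; have [->|Sc] := eqVneq (S c) 0; first by rewrite !mul0r mulr0.
rewrite mulrCA coef_dpath // coef_d2path // mulr_sumr; congr (_ * _).
apply: eq_bigr => n _; rewrite ba eqxx /=.
by case: eqP; rewrite ?mul0r ?mul1r.
Qed.

(** A rotation that starts with [a] and ends with [b] is one step after a rotation that starts with
    [b a]. *)
Lemma rdiv_cder a b : rdiv b (cder a S) = cder2 b a S.
Proof.
apply: path_coefP => i s; rewrite coef_rdiv !coef_linext.
apply: eq_fsbigr => c _; have [->|Sc] := eqVneq (S c) 0; first by rewrite !mul0r.
rewrite coef_dpath // coef_d2path //; congr (_ * _).
pose G n : K := ((i == tl a) && (rot n (ps c) == a :: rcons s b))%:R.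
(* Rotation by the full length is the identity, so the index n runs over a cyclic group and may be
   shifted by one. *)
have shift : \sum_(n < plen c) G n = \sum_(n < plen c) G n.+1.
  have : G (plen c) = G 0%N by rewrite /G rot_size rot0.
  case: (plen c) => [|l] El; first by rewrite !big_ord0.
  rewrite big_ord_recl big_ord_recr /= addrC; congr (_ + _).
  by rewrite El.
rewrite -[LHS]/(\sum_(n < plen c) G n) shift; apply: eq_bigr => n _.
rewrite /G -addn1 rotD ?addn1 //; congr (_ && _)%:R.
by rewrite rot_rot -rcons_cons -(rot1_cons b (a :: s)) (inj_eq (@rot_inj 1 _)).
Qed.

(** Every path in [cder a S] has tail k and positive length; the sum groups these paths by their
    last arrow. This relation gives [gamma_beta], and its mirror image below, grouping by the first
    arrow, gives [alpha_gamma]. *)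
Lemma sum_cder2_arr k a : hd a = k ->
  \sum_(b : outar Q k) cder2 (val b) a S * arr (val b) = cder a S.
Proof.
move=> ak; rewrite [RHS](@sum_arr_rdiv_at _ _ _ (outar Q k) val k) //.
- by apply: eq_bigr => b _; rewrite rdiv_cder.
- exact: val_inj.
- by move=> c /eqP ck; apply/codomP; exists (Sub c ck); rewrite SubK.
- exact: order_ge_cder.
- by rewrite -ak cder_idem.
Qed.

Lemma sum_arr_cder2 k b : tl b = k ->
  \sum_(a : inar Q k) arr (val a) * cder2 b (val a) S = cder b S.
Proof.
move=> bk; rewrite [RHS](@sum_arr_ldiv_at _ _ _ (inar Q k) val k) //.
- by apply: eq_bigr => a _; rewrite ldiv_cder // bk (eqP (valP a)).
- exact: val_inj.
- by move=> c /eqP ck; apply/codomP; exists (Sub c ck); rewrite SubK.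
- exact: order_ge_cder.
- by rewrite -bk idem_cder.
Qed.

End CyclicDerivatives.

(** * The morphisms kappa and psi *)

Section IdemHat.
Variables (K : fieldType) (I : finType) (Q : quiver I).
Implicit Types (u : cpa K Q) (k j : I) (s : seq Q).

Lemma coef_idemhatM k u i s : coef (idemhat K Q k * u) i s = (i != k)%:R * coef u i s.
Proof.
rewrite mulrBl mul1r path_coefB coef_idemM; case: eqP; rewrite ?mul1r ?mul0r ?subrr ?subr0 //.
Qed.

Lemma coef_Midemhat k u i s :
  coef (u * idemhat K Q k) i s = coef u i s * (stail i s != k)%:R.
Proof.
rewrite mulrBr mulr1 path_coefB coef_Midem; case: eqP; rewrite ?mulr1 ?mulr0 ?subrr ?subr0 //.
Qed.

Lemma idemhat_idem k : idemhat K Q k * idem k = 0.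
Proof. by rewrite mulrBl mul1r idemM eqxx subrr. Qed.
Lemma idem_idemhat k : idem k * idemhat K Q k = 0.
Proof. by rewrite mulrBr mulr1 idemM eqxx subrr. Qed.
Lemma idemhatM k : idemhat K Q k * idemhat K Q k = idemhat K Q k.
Proof. by rewrite {2}/idemhat mulrBr idemhat_idem mulr1 subr0. Qed.
Lemma idemhat_idem_neq k j : j != k -> idemhat K Q k * idem j = idem j.
Proof. by move=> jk; rewrite mulrBl mul1r idemM eq_sym (negbTE jk) subr0. Qed.
Lemma idem_idemhat_neq k j : j != k -> idem j * idemhat K Q k = idem j.
Proof. by move=> jk; rewrite mulrBr mulr1 idemM (negbTE jk) subr0. Qed.

Lemma patheltM i s j t : pathb i s -> pathb j t ->
  pathelt K (i, s) * pathelt K (j, t) =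
  if stail i s == j then pathelt K (i, s ++ t) else 0 :> cpa K Q.
Proof.
move=> + jt; elim: s i => [|c s IH] i /=.
  move=> _; apply: path_coefP => l r; rewrite coef_idemM (fun_if (fun u => coef u l r)).
  rewrite path_coef0 !coef_pathelt !xpair_eqE /stail /=.
  case: (i =P j) => [->|ij]; first by case: (l == j); rewrite ?mul1r ?mul0r ?andbF.
  by case: (l =P i) => [->|]; rewrite ?mul0r //; move/eqP/negbTE: ij => ->; rewrite andbF mulr0.
move=> csP; have [_ sP] := andP csP; rewrite pathelt_cons // -mulrA IH //.
rewrite -/(stail (tl c) s) [stail i _]/(stail (tl c) s); case: eqP => E; last by rewrite mulr0.
by rewrite (@pathelt_cons _ _ _ i c (s ++ t)) //= (andP csP).1 pathb_cat sP E.
Qed.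
End IdemHat.

Lemma tl_StarIn (I : finType) (Q : quiver I) (k : I) (a : inar Q k) :
  tl (StarIn a : premut Q k) = k.
Proof. exact: eqP (valP a). Qed.
Lemma hd_StarOut (I : finType) (Q : quiver I) (k : I) (b : outar Q k) :
  hd (StarOut b : premut Q k) = k.
Proof. exact: eqP (valP b). Qed.

Section Kappa.
Variables (K : fieldType) (I : finType) (Q : quiver I) (k : I).
Notation Q1 := (premut Q k).
Notation Q2 := (del (premut Q1 k) k).
Implicit Types (u v : cpa K Q1) (c : Q2) (s : seq Q2) (q : qpath Q2).

(** [expand_arrow] is empty only on starred arrows of the second premutation, which meet k and hence
    are not in [Q2]. *)
Lemma expand_arrow_nz c : expand_arrow c != [::].
Proof.
case: c => -[z|x y|x|x] cP //; exfalso; move: cP.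
  by rewrite tl_StarIn eqxx andbF.
by rewrite hd_StarOut eqxx.
Qed.

(** Unique readability. The first letter decides which kind of arrow was expanded: a plain letter
    has its tail off k, whereas [a^* b^*] begins with a letter whose tail is k. *)
Lemma expand_cat_inj c c' (r r' : seq Q1) :
  expand_arrow c ++ r = expand_arrow c' ++ r' -> c = c' /\ r = r'.
Proof.
have star1 (x : inar Q1 k) : ~~ ((hd (StarIn x : premut Q1 k) != k) &&
    (tl (StarIn x : premut Q1 k) != k)) by rewrite tl_StarIn eqxx andbF.
have star2 (x : outar Q1 k) : ~~ ((hd (StarOut x : premut Q1 k) != k) &&
    (tl (StarOut x : premut Q1 k) != k)) by rewrite hd_StarOut eqxx.
have plain_out (z : plain Q1 k) (x : outar Q1 k) : val z <> val x.
  by move=> E; have /andP[_] := valP z; rewrite E (eqP (valP x)) eqxx.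
case: c => -[z|x y|x|x] cP; case: c' => -[z'|x' y'|x'|x'] cP' /=;
  try by [case/negP: (star1 x)|case/negP: (star1 x')|case/negP: (star2 x)|case/negP: (star2 x')].
- by case=> /val_inj zz ->; split=> //; apply: val_inj; rewrite /= zz.
- by case=> /plain_out.
- by case=> /esym /plain_out.
by case=> /val_inj xx /val_inj yy ->; split=> //; apply: val_inj; rewrite /= xx yy.
Qed.

Lemma expand_seq_inj : injective (@expand_seq I Q k).
Proof.
elim=> [|c s IH] [|c' s'] //.
- by rewrite /expand_seq /=; case: (expand_arrow c') (expand_arrow_nz c') => //=.
- by rewrite /expand_seq /=; case: (expand_arrow c) (expand_arrow_nz c) => //=.
by rewrite /expand_seq /= => /expand_cat_inj[-> /IH ->].
Qed.

Lemma expand_inj : injective (@expand I Q k).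
Proof.
move=> q q' /(congr1 val) [/val_inj E /expand_seq_inj E']; apply: val_inj.
by move: E E'; rewrite /ph /ps; case: (val q) (val q') => [i s] [i' s'] /= -> ->.
Qed.

Lemma size_expand_seq s : (size (expand_seq s) <= (size s).*2)%N.
Proof.
elim: s => //= c s IH; rewrite /expand_seq /= size_cat doubleS -addn2 addnC.
by apply: leq_add => //; case: c => -[].
Qed.

Lemma stail_expand i s : pathb i s ->
  stail (val i) (expand_seq s) = val (stail i s).
Proof.
elim: s i => //= c s IH i /andP[/eqP <- sP].
by rewrite /expand_seq /= stail_cat (expand_arrowP c).2 IH.
Qed.

Lemma kappaP a u v : kappa (a *: u + v) = a *: kappa u + kappa v.
Proof. by []. Qed.

Lemma kappa_pathelt q : kappa (pathelt K (val (expand q))) = pathelt K (val q).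
Proof.
apply: cpaE => q'; rewrite /kappa /pathelt.
by rewrite !(inj_eq val_inj) (inj_eq expand_inj).
Qed.

Lemma kappa_order n u : order_ge n u -> order_ge n./2 (kappa u).
Proof.
move=> hu q qn; apply: hu; apply: leq_ltn_trans (size_expand_seq _) _.
by move: qn; rewrite geq_half_double doubleS => /ltnW.
Qed.

(** An expanded word has more cutting places than the original one. The extra ones lie inside some
    [a^* b^*]; there the left part ends with an arrow whose tail is k, and the hypothesis makes [G]
    vanish. *)
Lemma sum_expand (G : seq Q1 -> seq Q1 -> K) s :
  (forall t x r, tl x = k -> G (rcons t x) r = 0) ->
  \sum_(n < (size (expand_seq s)).+1) G (take n (expand_seq s)) (drop n (expand_seq s)) =
  \sum_(n < (size s).+1) G (expand_seq (take n s)) (expand_seq (drop n s)).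
Proof.
elim: s G => [|c s IH] G G0; first by rewrite !big_ord1.
(* The induction moves the first arrow into the left part, so [G] is shifted by the expansion of
   that arrow. *)
pose G' t r := G (expand_arrow c ++ t) r.
have G'0 t x r : tl x = k -> G' (rcons t x) r = 0.
  by move=> xk; rewrite /G' -rcons_cat G0.
rewrite [RHS]big_ord_recl; under [in RHS]eq_bigr do rewrite /=.
rewrite -[X in _ = _ + X](IH G' G'0) /G' [expand_seq (c :: s)]/(expand_arrow c ++ expand_seq s).
case: c {G' G'0} => -[z|x y|x|x] cP /=.
- by rewrite big_ord_recl.
- by rewrite !big_ord_recl /= [X in _ + (X + _)](G0 [::]) ?add0r //; exact: (eqP (valP x)).
- by move: (cP); rewrite tl_StarIn eqxx andbF.
by move: (cP); rewrite hd_StarOut eqxx.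
Qed.

(** Since no path of [u] has tail k, the cuts inside [a^* b^*] do not contribute to the product. *)
Lemma kappaM u v : u * idemhat K Q1 k = u -> kappa (u * v) = kappa u * kappa v.
Proof.
move=> uk; apply: cpaE => q; rewrite /kappa -path_coefE path_coefM /=.
pose G t r := coef u (val (ph q)) t * coef v (stail (val (ph q)) t) r.
rewrite (sum_expand (G := G)) => [|t x r xk]; last first.
  by rewrite /G -uk coef_Midemhat stail_rcons xk eqxx mulr0 mul0r.
rewrite cpaM; apply: eq_bigr => n _; rewrite /G stail_expand ?ptake_subproof //.
by congr (_ * _); rewrite -path_coefE.
Qed.
End Kappa.

(** * Multiplicativity and order estimates for psi and its composite with kappa *)

Section PsiMorphism.
Variables (K : fieldType) (I : finType) (Q : quiver I) (k : I) (S : cpa K Q).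
Notation Q1 := (premut Q k).
Notation Q2 := (del (premut Q1 k) k).
Hypotheses (Q_loop_free : loop_free Q) (S_potential : potential S).
Hypothesis k_cycle : not_in_two_cycle Q k.
Implicit Types (u v : cpa K Q2) (c : Q2) (s : seq Q2) (q : qpath Q2).

Lemma inar_tl (a : inar Q k) : tl (val a) != k.
Proof. by have := Q_loop_free (val a); rewrite (eqP (valP a)) eq_sym. Qed.
Lemma outar_hd (b : outar Q k) : hd (val b) != k.
Proof. by have := Q_loop_free (val b); rewrite (eqP (valP b)). Qed.

Lemma psi_arrow_order c : order_ge 1 (psi_arrow S c).
Proof.
rewrite /psi_arrow; case: (val c) => [z|x y|x|x] //.
  case: (val z) => [z'|b a|a|b] //; first exact: order_ge_arr.
  by apply: (order_geM (m := 1) (n := 0)) => //; apply: order_ge_arr.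
case: (val x) => // a; case: (val y) => // b p pn.
have -> : (- cder2 (val b) (val a) S) p = - cder2 (val b) (val a) S p by [].
rewrite order_ge_cder2 ?oppr0 //; apply/eqP => E.
have := k_cycle (etrans (eqP (valP a)) (esym (eqP (valP b)))) (esym E).
by rewrite (eqP (valP a)) eqxx => -[].
Qed.

Lemma idem_psi_arrow c : idem (val (hd c)) * psi_arrow S c = psi_arrow S c.
Proof.
rewrite /psi_arrow /=; case: (val c) => [z|x y|x|x] /=; rewrite ?mulr0 //.
  case: (val z) => [z'|b a|a|b] /=; rewrite ?mulr0 ?mulrA ?idem_arr //.
case: (val x) => [?|? ?|a|?]; rewrite ?mulr0 //; case: (val y) => [?|? ?|?|b]; rewrite ?mulr0 //.
by rewrite mulrN idem_cder2.
Qed.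

Lemma psi_arrow_idem c : psi_arrow S c * idem (val (tl c)) = psi_arrow S c.
Proof.
rewrite /psi_arrow /=; case: (val c) => [z|x y|x|x] /=; rewrite ?mul0r //.
  by case: (val z) => [z'|b a|a|b] /=; rewrite ?mul0r -?mulrA ?arr_idem.
case: (val x) => [?|? ?|a|?]; rewrite ?mul0r //; case: (val y) => [?|? ?|?|b]; rewrite ?mul0r //.
by rewrite mulNr cder2_idem.
Qed.

(** [psi_path] on a bare word, so that products can be computed by induction on the word. *)
Definition psi_seq (i : {j | j != k}) s : cpa K Q :=
  idem (val i) * \prod_(c <- s) psi_arrow S c.

Lemma psi_seq_cons c s : psi_seq (hd c) (c :: s) = psi_arrow S c * psi_seq (tl c) s.
Proof. by rewrite /psi_seq big_cons !mulrA idem_psi_arrow psi_arrow_idem. Qed.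

Lemma psi_seqM i s j t : pathb i s ->
  psi_seq i s * psi_seq j t = if stail i s == j then psi_seq i (s ++ t) else 0.
Proof.
elim: s i => [|c s IH] i /= => [_|/andP[/eqP <- sP]].
  rewrite /psi_seq big_nil mulr1 mulrA idemM (inj_eq val_inj) /stail /=.
  by case: eqP; rewrite ?mul0r.
rewrite !psi_seq_cons -mulrA IH // [stail _ (c :: s)]/(stail (tl c) s).
by case: eqP; rewrite ?mulr0.
Qed.

(** This is the continuity of psi: it supplies the bound on which the rules for [linext] rest. *)
Lemma psi_path_order q : order_ge (plen q) (psi_path S q).
Proof.
rewrite /psi_path -[plen q]add0n; apply: order_geM => //; rewrite /plen.
elim: (ps q) => [|c s IH] //; rewrite big_cons /= -add1n.
by apply: order_geM => //; apply: psi_arrow_order.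
Qed.

Lemma psi_pathelt q : psi S (pathelt K (val q)) = psi_path S q.
Proof. exact: linext_pathelt. Qed.

Lemma psiP a u v : psi S (a *: u + v) = a *: psi S u + psi S v.
Proof. exact/linextP/psi_path_order. Qed.

Lemma psiM u v : psi S (u * v) = psi S u * psi S v.
Proof.
apply: linextM; first exact: psi_path_order.
move=> q q'; rewrite -[RHS]/(psi_seq (ph q) (ps q) * psi_seq (ph q') (ps q')).
rewrite (psi_seqM _ _ (qpathP q)).
have pq : val q = (ph q, ps q) by rewrite /ph /ps; case: (val q).
have pq' : val q' = (ph q', ps q') by rewrite /ph /ps; case: (val q').
rewrite pq pq' patheltM ?qpathP //; case: eqP => E; last exact/linext0/psi_path_order.
have h : pathb (ph q) (ps q ++ ps q') by rewrite pathb_cat E !qpathP.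
exact: (linext_pathelt _ (@QPath _ _ (_, _) h)).
Qed.

Lemma idemhat_psi u : idemhat K Q k * psi S u = psi S u.
Proof.
apply: path_coefP => i s; rewrite coef_idemhatM; case: eqP => [->|_]; last by rewrite mul1r.
rewrite mul0r coef_linext fsbig1 // => q _.
by rewrite /psi_path coef_idemM eq_sym (negbTE (valP (ph q))) mul0r mulr0.
Qed.

Definition psi_kappa (u : cpa K Q1) : cpa K Q := psi S (kappa u).

Lemma psi_kappaP a (u v : cpa K Q1) : psi_kappa (a *: u + v) = a *: psi_kappa u + psi_kappa v.
Proof. by rewrite /psi_kappa kappaP psiP. Qed.

Lemma psi_kappaM (u v : cpa K Q1) : u * idemhat K Q1 k = u ->
  psi_kappa (u * v) = psi_kappa u * psi_kappa v.
Proof. by move=> uk; rewrite /psi_kappa kappaM // psiM. Qed.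

Lemma psi_kappa_order n (u : cpa K Q1) : order_ge n u -> order_ge n./2 (psi_kappa u).
Proof. by move=> /kappa_order; apply/linext_order/psi_path_order. Qed.

Lemma psi_kappa_pathelt q : psi_kappa (pathelt K (val (expand q))) = psi_path S q.
Proof. by rewrite /psi_kappa kappa_pathelt psi_pathelt. Qed.

Lemma psi_kappa_idem j : j != k -> psi_kappa (idem j) = idem j.
Proof.
move=> jk; pose q : qpath Q2 := @QPath _ Q2 (Sub j jk : {j | j != k}, [::]) isT.
have := psi_kappa_pathelt q; rewrite /psi_path big_nil mulr1 /=.
by move=> E; exact: E.
Qed.

Lemma arrow_pathb c : pathb (hd c) [:: c]. Proof. by rewrite /= eqxx. Qed.

Lemma psi_kappa_arrow c :
  psi_kappa (pathelt K (val (hd c), expand_arrow c)) = psi_arrow S c.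
Proof.
have := psi_kappa_pathelt (@QPath _ Q2 (_, _) (arrow_pathb c)).
rewrite /= /expand_seq /= cats0 => ->.
by rewrite /psi_path /= big_seq1 idem_psi_arrow.
Qed.

Lemma psi_kappa_plain (z : plain Q k) : psi_kappa (arr (Plain z : Q1)) = arr (val z).
Proof. exact: (psi_kappa_arrow (Sub (Plain (Sub (Plain z : Q1) (valP z))) (valP z) : Q2)). Qed.

Lemma psi_kappa_comp (b : outar Q k) (a : inar Q k) :
  psi_kappa (arr (Comp b a : Q1)) = arr (val b) * arr (val a).
Proof.
have h : (hd (Comp b a : Q1) != k) && (tl (Comp b a : Q1) != k).
  by rewrite /= outar_hd inar_tl.
exact: (psi_kappa_arrow (Sub (Plain (Sub (Comp b a : Q1) h)) h : Q2)).
Qed.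

Lemma psi_kappa_star (a : inar Q k) (b : outar Q k) :
  psi_kappa (arr (StarIn a : Q1) * arr (StarOut b : Q1)) = - cder2 (val b) (val a) S.
Proof.
(* Starring reverses arrows: in [Q1] the arrow [a^*] starts at k and [b^*] ends at k, so the arrow
   of [Q2] in question is [Comp x y]. *)
pose x : outar Q1 k := Sub (StarIn a : Q1) (valP a).
pose y : inar Q1 k := Sub (StarOut b : Q1) (valP b).
have h : (hd (Comp x y : premut Q1 k) != k) && (tl (Comp x y : premut Q1 k) != k).
  by rewrite /= inar_tl outar_hd.
rewrite -[RHS]/(psi_arrow S (Sub (Comp x y) h : Q2)) -psi_kappa_arrow; congr psi_kappa.
rewrite /= patheltM /= ?eqxx //.
by rewrite /stail /= (eqP (valP a)) (eqP (valP b)) eqxx.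
Qed.

End PsiMorphism.

(** * The block decomposition of the premutated path algebra *)

Section DivisionRules.
Variables (K : fieldType) (I : finType) (Q : quiver I).
Implicit Types (u : cpa K Q) (c : Q) (k : I).

Lemma rdivP c a u v : rdiv c (a *: u + v) = a *: rdiv c u + rdiv c v.
Proof.
by apply: path_coefP => i s;
  rewrite path_coefD path_coefZ !coef_rdiv path_coefD path_coefZ.
Qed.

Lemma ldivP c a u v : ldiv c (a *: u + v) = a *: ldiv c u + ldiv c v.
Proof.
by apply: path_coefP => i s;
  rewrite path_coefD path_coefZ !coef_ldiv path_coefD path_coefZ mulrDr mulrCA.
Qed.

Lemma rdiv_Marr c c' u : rdiv c (u * arr c') = if c == c' then u * idem (hd c) else 0.
Proof.
apply: path_coefP => i s; rewrite coef_rdiv coef_Marr (fun_if (fun u => coef u i s)).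
rewrite path_coef0 coef_Midem; case: eqP => [->|_] /=; last by rewrite mul0r.
by rewrite mulrC.
Qed.

Lemma ldiv_arrM c c' u : ldiv c (arr c' * u) = if c == c' then idem (tl c) * u else 0.
Proof.
apply: path_coefP => i s; rewrite coef_ldiv coef_arrM (fun_if (fun u => coef u i s)).
rewrite path_coef0 coef_idemM; case: (c =P c') => [->|_] /=; last by rewrite mul0r mulr0.
by rewrite eqxx mul1r; case: eqP => [->|]; rewrite ?mul0r.
Qed.

Lemma rdiv_Midemhat c u k : tl c = k -> rdiv c (u * idemhat K Q k) = 0.
Proof.
move=> ck; apply: path_coefP => i s.
by rewrite coef_rdiv coef_Midemhat stail_rcons ck eqxx mulr0 path_coef0.
Qed.

Lemma ldiv_idemhatM c u k : hd c = k -> ldiv c (idemhat K Q k * u) = 0.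
Proof.
move=> ck; apply: path_coefP => i s.
by rewrite coef_ldiv coef_idemhatM ck eqxx mul0r mulr0 path_coef0.
Qed.

Lemma rdiv0 c : rdiv c 0 = 0 :> cpa K Q.
Proof. by apply: path_coefP => i s; rewrite coef_rdiv !path_coef0. Qed.

Lemma ldiv0 c : ldiv c 0 = 0 :> cpa K Q.
Proof. by apply: path_coefP => i s; rewrite coef_ldiv !path_coef0 mulr0. Qed.

Lemma rdiv_order n c u : order_ge n.+1 u -> order_ge n (rdiv c u).
Proof.
move=> /order_ge_coef hu; apply/order_ge_coef => i s sn.
by rewrite coef_rdiv hu // size_rcons.
Qed.

Lemma ldiv_order n c u : order_ge n.+1 u -> order_ge n (ldiv c u).
Proof.
move=> /order_ge_coef hu; apply/order_ge_coef => i s sn.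
by rewrite coef_ldiv hu ?mulr0.
Qed.
End DivisionRules.

Section Decomposition.
Variables (K : fieldType) (I : finType) (Q : quiver I) (k : I).
Hypothesis Q_loop_free : loop_free Q.
Notation Q1 := (premut Q k).
Notation ehat := (idemhat K Q1 k).
Notation ek := (idem k : cpa K Q1).
Notation sin a := (arr (StarIn a : Q1) : cpa K Q1).
Notation sout b := (arr (StarOut b : Q1) : cpa K Q1).
Implicit Types (u v x : cpa K Q1) (a : inar Q k) (b : outar Q k).

(** Written as divisions, the components inherit linearity and their values on products from the
    division rules. [compx] has no factor [ehat], because [b^*] and [a^*] already force both ends of
    the path to be k. *)
Lemma compvE u a : compv u a = rdiv (StarIn a : Q1) (ehat * u).
Proof.
apply: cpaE => p; rewrite /compv /rdiv /pt coef_idemhatM /=.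
by case: (ph p =P k) => [->|_]; rewrite /= ?mul0r ?mul1r ?if_same.
Qed.

Lemma compwE u b : compw u b = ldiv (StarOut b : Q1) (u * ehat).
Proof.
apply: cpaE => p; rewrite /compw /ldiv coef_Midemhat hd_StarOut /=.
case: eqP => //= E; rewrite /stail /= -E -/(stail _ _) -/(pt p).
by case: eqP; rewrite ?mulr0 ?mulr1.
Qed.

Lemma compxE u a b : compx u a b = ldiv (StarOut b : Q1) (rdiv (StarIn a : Q1) u).
Proof.
apply: path_coefP => i s; rewrite coef_ldiv coef_rdiv hd_StarOut /=.
rewrite (coef_fun (f := fun i s => if (i == hd (val b)) && (stail i s == tl (val a))
  then coef u k ((StarOut b : Q1) :: rcons s (StarIn a : Q1)) else 0)).
  case: eqP => [->|] /=; last by rewrite mul0r.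
  rewrite mul1r; case: eqP => // /eqP ne; rewrite coef_nonpath //= pathb_rcons.
  by rewrite eq_sym in ne; rewrite (negbTE ne) !andbF.
case: eqP => //= -> ns; rewrite [coef _ _ (_ :: _)]coef_nonpath ?if_same //=.
by rewrite pathb_rcons (negbTE ns) !andbF.
Qed.

Lemma StarIn_inj : injective (fun a => StarIn a : Q1). Proof. by move=> a a' []. Qed.
Lemma StarOut_inj : injective (fun b => StarOut b : Q1). Proof. by move=> b b' []. Qed.

(** Without loops at k, [[ba]] has its tail off k and so does [b^*]; only the arrows [a^*] start at
    k. *)
Lemma tl_codom (c : Q1) : tl c = k -> c \in codom (fun a => StarIn a : Q1).
Proof.
case: c => [z|b a|a|b] /= E; last 1 first.
- by have := outar_hd Q_loop_free b; rewrite E eqxx.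
- by have /andP[_] := valP z; rewrite E eqxx.
- by have := inar_tl Q_loop_free a; rewrite E eqxx.
by apply/codomP; exists a.
Qed.

Lemma hd_codom (c : Q1) : hd c = k -> c \in codom (fun b => StarOut b : Q1).
Proof.
case: c => [z|b a|a|b] /= E.
- by have /andP[] := valP z; rewrite E eqxx.
- by have := outar_hd Q_loop_free b; rewrite E eqxx.
- by have := inar_tl Q_loop_free a; rewrite E eqxx.
by apply/codomP; exists b.
Qed.

Lemma sum_compv u : \sum_a compv u a * sin a = ehat * u * ek.
Proof.
have o1 : order_ge 1 (ehat * u * ek).
  apply/order_ge_coef => i [|//] _; rewrite coef_Midem coef_idemhatM /stail /=.
  by case: eqP; rewrite ?mul0r ?mulr0.
rewrite [RHS](sum_arr_rdiv_at StarIn_inj tl_codom o1); last first.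
  by rewrite -mulrA idemM eqxx.
apply: eq_bigr => a _; congr (_ * _); rewrite compvE; apply: path_coefP => i s.
by rewrite !coef_rdiv coef_Midem stail_rcons tl_StarIn eqxx mulr1.
Qed.

Lemma sum_compw u : \sum_b sout b * compw u b = ek * u * ehat.
Proof.
have o1 : order_ge 1 (ek * u * ehat).
  apply/order_ge_coef => i [|//] _; rewrite coef_Midemhat coef_idemM /stail /=.
  by case: eqP; rewrite ?mul0r ?mulr0.
rewrite [RHS](sum_arr_ldiv_at StarOut_inj hd_codom o1); last first.
  by rewrite !mulrA idemM eqxx.
apply: eq_bigr => b _; congr (_ * _); rewrite compwE; apply: path_coefP => i s.
by rewrite !coef_ldiv !coef_Midemhat coef_idemM hd_StarOut eqxx mul1r.
Qed.

(** Without its constant term [ek * u * ek] has positive order, so a first arrow [b^*] can be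
    removed. What is left runs from k to the head of [b], which is not k; it again has positive
    order, and a last arrow [a^*] can be removed. *)
Lemma sum_compx u :
  \sum_a \sum_b sout b * compx u a b * sin a = ek * u * ek - compz u *: ek.
Proof.
set w := RHS; have wE i s : coef w i s = (i == k)%:R * coef u i s * (stail i s == k)%:R -
    coef u k [::] * ((i == k) && (s == [::]))%:R.
  by rewrite /w path_coefB coef_Midem coef_idemM path_coefZ coef_idem.
have o1 : order_ge 1 w.
  apply/order_ge_coef => i [|//] _; rewrite wE /stail /= andbT.
  by case: eqP => [->|]; rewrite ?mul1r ?mulr1 ?mul0r ?mulr0 subrr.
rewrite (sum_arr_ldiv_at StarOut_inj hd_codom o1); last first.
  by rewrite /w mulrBr !mulrA -cpa_scaleAr idemM eqxx.
rewrite exchange_big; apply: eq_bigr => b _; rewrite /=.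
under eq_bigr do rewrite -mulrA; rewrite -mulr_sumr; congr (_ * _).
rewrite [RHS](sum_arr_rdiv_at StarIn_inj tl_codom).
- apply: eq_bigr => a _; congr (_ * _); rewrite compxE; apply: path_coefP => i s.
  rewrite coef_ldiv !coef_rdiv coef_ldiv wE hd_StarOut eqxx mul1r andbF mulr0 subr0.
  by rewrite -[_ :: rcons _ _]/(rcons (_ :: _) _) stail_rcons tl_StarIn eqxx mulr1.
- apply/order_ge_coef => i [|//] _; rewrite coef_ldiv wE /stail /= andbF.
  by rewrite (negbTE (outar_hd Q_loop_free b)) !mulr0 subr0 mulr0.
apply: path_coefP => i s; rewrite coef_Midem !coef_ldiv; case: (stail i s =P k) => [_|/eqP ne].
  by rewrite mulr1.
case: (i =P _) => [E|]; rewrite ?mul0r // wE [stail _ (_ :: _)]/(stail (tl (StarOut b : Q1)) s).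
by rewrite -E (negbTE ne) !mulr0 andbF mulr0 subr0 mulr0.
Qed.

(** The Peirce decomposition for [1 = ehat + ek], with the three corners that touch k written
    out. *)
Lemma decomposition u : u = compz u *: ek + comphat u +
  \sum_a compv u a * sin a + \sum_b sout b * compw u b +
  \sum_a \sum_b sout b * compx u a b * sin a.
Proof.
rewrite sum_compv sum_compw sum_compx /comphat.
have one : 1 = ehat + ek by rewrite /idemhat subrK.
rewrite [RHS]addrC -!addrA addKr [RHS]addrC -!addrA.
have E : (ehat + ek) * u * (ehat + ek) = u by rewrite -one mulr1 mul1r.
rewrite -[LHS]E {one E}; move: ehat ek => e f; rewrite mulrDr !mulrDl -!addrA; congr (_ + _).
by rewrite addrCA.
Qed.

Lemma rdiv_idemhatM (c : Q1) u : rdiv c (ehat * u) = ehat * rdiv c u.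
Proof. by apply: path_coefP => i s; rewrite coef_rdiv !coef_idemhatM coef_rdiv. Qed.

Lemma ldiv_Midemhat (c : Q1) u : ldiv c (u * ehat) = ldiv c u * ehat.
Proof.
apply: path_coefP => i s; rewrite coef_ldiv !coef_Midemhat coef_ldiv.
by case: eqP => [->|]; rewrite ?mul0r ?mul1r.
Qed.

Lemma rdiv_StarIn_hat u a : rdiv (StarIn a : Q1) u * ehat = rdiv (StarIn a : Q1) u.
Proof.
apply: path_coefP => i s; rewrite coef_Midemhat coef_rdiv.
case: eqP => [E|_]; last by rewrite mulr1.
rewrite mulr0 coef_nonpath // pathb_rcons E /=.
by rewrite (negbTE (inar_tl Q_loop_free a)) andbF.
Qed.

Lemma ldiv_StarOut_hat u b : ehat * ldiv (StarOut b : Q1) u = ldiv (StarOut b : Q1) u.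
Proof.
apply: path_coefP => i s; rewrite coef_idemhatM coef_ldiv /=.
case: (i =P k) => [->|_]; last by rewrite mul1r.
by rewrite eq_sym (negbTE (outar_hd Q_loop_free b)) !mul0r.
Qed.

Definition hat x := ehat * x = x /\ x * ehat = x.

Lemma hat0 : hat 0. Proof. by split; rewrite ?mul0r ?mulr0. Qed.
Lemma hat_idemhat : hat ehat. Proof. by split; rewrite idemhatM. Qed.
Lemma hat_idem j : j != k -> hat (idem j).
Proof. by move=> jk; split; rewrite ?idemhat_idem_neq ?idem_idemhat_neq. Qed.
Lemma hat_tl a : hat (idem (tl (val a))).
Proof. exact/hat_idem/inar_tl. Qed.
Lemma hat_hd b : hat (idem (hd (val b))).
Proof. exact/hat_idem/outar_hd. Qed.
Lemma hatM x y : hat x -> hat y -> hat (x * y).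
Proof. by move=> [hx _] [_ hy]; split; rewrite ?mulrA ?hx // -mulrA hy. Qed.
Lemma hat_comphat u : hat (comphat u).
Proof. by split; rewrite /comphat ?mulrA ?idemhatM // -!mulrA idemhatM. Qed.
Lemma hat_compv u a : hat (compv u a).
Proof.
by rewrite compvE rdiv_idemhatM; split; rewrite ?mulrA ?idemhatM // -mulrA rdiv_StarIn_hat.
Qed.
Lemma hat_compw u b : hat (compw u b).
Proof.
by rewrite compwE ldiv_Midemhat; split; rewrite ?mulrA ?ldiv_StarOut_hat // -mulrA idemhatM.
Qed.
Lemma hat_compx u a b : hat (compx u a b).
Proof.
by rewrite compxE; split; rewrite ?ldiv_StarOut_hat // -ldiv_Midemhat rdiv_StarIn_hat.
Qed.

Lemma sin_ehat a : sin a * ehat = 0.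
Proof. by rewrite -arr_idem tl_StarIn -mulrA idem_idemhat mulr0. Qed.
Lemma ehat_sin a : ehat * sin a = sin a.
Proof. by rewrite -idem_arr mulrA idemhat_idem_neq //; apply: inar_tl. Qed.
Lemma ehat_sout b : ehat * sout b = 0.
Proof. by rewrite -idem_arr hd_StarOut mulrA idemhat_idem mul0r. Qed.
Lemma sout_ehat b : sout b * ehat = sout b.
Proof. by rewrite -arr_idem -mulrA idem_idemhat_neq //; apply: outar_hd. Qed.
Lemma hat_sin_sout a b : hat (sin a * sout b).
Proof.
split; first by rewrite mulrA ehat_sin.
by rewrite -mulrA [X in _ * X](sout_ehat b).
Qed.

Definition lblock (l : option (outar Q k)) : cpa K Q1 :=
  if l is Some b then sout b else ehat.
Definition rblock (r : option (inar Q k)) : cpa K Q1 :=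
  if r is Some a then sin a else ehat.

(** Blocks and [ek] span the whole complete algebra by finite combinations, so closure of [P] under
    limits never enters. *)
Lemma block_ind (P : cpa K Q1 -> Prop) :
  (forall c u v, P u -> P v -> P (c *: u + v)) -> P ek ->
  (forall l x r, hat x -> P (lblock l * x * rblock r)) -> forall u, P u.
Proof.
move=> PL Pek Pb u; have P0 : P 0.
  by have := Pb None 0 None hat0; rewrite mulr0 mul0r.
have PD u1 u2 : P u1 -> P u2 -> P (u1 + u2).
  by move=> P1 P2; rewrite -[u1]scale1r; apply: PL.
have Psum (J : finType) (F : J -> cpa K Q1) : (forall j, P (F j)) -> P (\sum_j F j).
  by move=> PF; apply: big_ind.
rewrite (decomposition u); apply: (PD); [apply: (PD); [apply: (PD)|]|].
- apply: PL => //; have [h1 h2] := hat_comphat u.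
  have -> : comphat u = ehat * comphat u * ehat by rewrite h1 h2.
  exact: (Pb None _ None (hat_comphat u)).
- apply: (Psum) => a; have h := hat_compv u a; rewrite -h.1.
  exact: (Pb None _ (Some a)).
- apply: (Psum) => b; have h := hat_compw u b; rewrite -h.2 mulrA.
  exact: (Pb (Some b) _ None).
apply: (Psum) => a; apply: (Psum) => b; exact: (Pb (Some b) _ (Some a) (hat_compx u a b)).
Qed.

(** * Extending a multiplicative map from the corner eAe to A *)

Section Extension.
Variables (N : lmodType K) (T : cpa K Q1 -> endo N) (Pk : endo N).
Variables (sa : inar Q k -> endo N) (sb : outar Q k -> endo N).

(** The shape of [eta_tilde] with its ingredients abstracted: [T] stands for [Theta], [Pk] for the
    projection onto Mbar_k, [sa] and [sb] for the actions of the starred arrows. The relations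
    assumed on them below are exactly those to be verified for the mutated representation. *)
Definition block_ext u : endo N :=
  compz u *: Pk + T (comphat u) + \sum_a T (compv u a) * sa a
  + \sum_b sb b * T (compw u b) + \sum_a \sum_b sb b * T (compx u a b) * sa a.

Lemma endo_scaleAl c (f g : endo N) : c *: (f * g) = (c *: f) * g.
Proof. by apply: endoP. Qed.
Lemma endo_scaleAr c (f g : endo N) : c *: (f * g) = f * (c *: g).
Proof.
by apply: endoP => x; transitivity (f (c *: g x)); first by rewrite linearZ.
Qed.

Hypothesis T_linear : linear T.

Lemma T0 : T 0 = 0.
Proof.
have := T_linear 1 0 0; rewrite !scale1r addr0.
by move/(congr1 (fun f => f - T 0)); rewrite subrr addrK.
Qed.

Lemma compv_linear a : linear (fun u => compv u a).
Proof. by move=> c u v; rewrite !compvE mulrDr -cpa_scaleAr rdivP. Qed.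
Lemma compw_linear b : linear (fun u => compw u b).
Proof. by move=> c u v; rewrite !compwE mulrDl -cpa_scaleAl ldivP. Qed.
Lemma compx_linear a b : linear (fun u => compx u a b).
Proof. by move=> c u v; rewrite !compxE rdivP ldivP. Qed.
Lemma comphat_linear : linear (@comphat K I Q k).
Proof.
by move=> c u v; rewrite /comphat; move: ehat => e; rewrite mulrDr mulrDl -cpa_scaleAr -cpa_scaleAl.
Qed.

Lemma block_ext_linear : linear block_ext.
Proof.
have linD (f g : cpa K Q1 -> endo N) :
    linear f -> linear g -> linear (fun u => f u + g u).
  by move=> fl gl c u v; rewrite fl gl scalerDr addrACA.
have linS (J : finType) (F : J -> cpa K Q1 -> endo N) :
    (forall j, linear (F j)) -> linear (fun u => \sum_j F j u).
  move=> Fl c u v; rewrite scaler_sumr -big_split; apply: eq_bigr => j _; exact: Fl.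
have linM f (l r : endo N) : linear f -> linear (fun u => l * T (f u) * r).
  by move=> fl c u v; rewrite fl T_linear mulrDr mulrDl endo_scaleAl endo_scaleAr.
have linMl f (l : endo N) : linear f -> linear (fun u => l * T (f u)).
  by move=> fl c u v; rewrite fl T_linear mulrDr endo_scaleAr.
have linMr f (r : endo N) : linear f -> linear (fun u => T (f u) * r).
  by move=> fl c u v; rewrite fl T_linear mulrDl endo_scaleAl.
apply: (linD); [apply: (linD); [apply: (linD); [apply: (linD)|]|]|].
- by move=> c u v; rewrite /compz path_coefD path_coefZ scalerDl scalerA.
- by move=> c u v; rewrite comphat_linear T_linear.
- by apply: linS => a; apply/linMr/compv_linear.
- by apply: linS => b; apply/linMl/compw_linear.
by apply: (linS) => a; apply: linS => b; apply/linM/compx_linear.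
Qed.

Hypothesis TM : forall x y, hat x -> hat y -> T (x * y) = T x * T y.
Hypothesis T_sin_sout : forall a b, T (sin a * sout b) = sa a * sb b.
Hypothesis T_sa : forall a, T (idem (tl (val a))) * sa a = sa a.
Hypothesis sb_T : forall b, sb b * T (idem (hd (val b))) = sb b.
Hypotheses (PkPk : Pk * Pk = Pk) (T1 : T ehat + Pk = 1).
Hypotheses (sa_Pk : forall a, sa a * Pk = sa a) (Pk_sb : forall b, Pk * sb b = sb b).

Definition lval (l : option (outar Q k)) : endo N := if l is Some b then sb b else T ehat.
Definition rval (r : option (inar Q k)) : endo N := if r is Some a then sa a else T ehat.

Lemma T_Pk x : hat x -> T x * Pk = 0.
Proof.
move=> hx; rewrite -{1}hx.2 (TM hx hat_idemhat) -mulrA.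
have -> : T ehat = 1 - Pk by rewrite -T1 addrK.
by rewrite mulrBl mul1r PkPk subrr mulr0.
Qed.

Lemma Pk_T x : hat x -> Pk * T x = 0.
Proof.
move=> hx; rewrite -{1}hx.1 (TM hat_idemhat hx) mulrA.
have -> : T ehat = 1 - Pk by rewrite -T1 addrK.
by rewrite mulrBr mulr1 PkPk subrr mul0r.
Qed.

Lemma compz_hat x : hat x -> compz x = 0.
Proof. by move=> hx; rewrite /compz -hx.1 coef_idemhatM eqxx mul0r. Qed.

Lemma compz_Mhat u x : hat x -> compz (u * x) = 0.
Proof.
by move=> hx; rewrite /compz -hx.2 mulrA coef_Midemhat /stail /= eqxx mulr0.
Qed.

Lemma block_ext_hat x : hat x -> block_ext x = T x.
Proof.
move=> hx; rewrite /block_ext compz_hat // scale0r add0r.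
rewrite /comphat hx.1 hx.2 !big1 ?addr0 // => [a _|b _|a _].
- rewrite big1 // => b _; rewrite compxE -hx.2 rdiv_Midemhat ?tl_StarIn //.
  by rewrite ldiv0 T0 mulr0 mul0r.
- rewrite compwE hx.2 -hx.1 ldiv_idemhatM ?hd_StarOut //.
  by rewrite T0 mulr0.
rewrite compvE hx.1 -hx.2 rdiv_Midemhat ?tl_StarIn //.
by rewrite T0 mul0r.
Qed.

Lemma block_ext_sin x a : hat x -> block_ext (x * sin a) = T x * sa a.
Proof.
move=> hx; have h1 : x * sin a * ehat = 0 by rewrite -mulrA sin_ehat mulr0.
have h2 : ehat * (x * sin a) = x * sin a by rewrite mulrA hx.1.
rewrite /block_ext {1}/compz coef_Marr_nil scale0r add0r.
have Ev : \sum_a' T (compv (x * sin a) a') * sa a' = T x * sa a.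
  rewrite (bigD1 a) //= big1 => [|a' a'a]; last first.
    by rewrite compvE h2 rdiv_Marr (inj_eq StarIn_inj) (negbTE a'a) T0 mul0r.
  (* Division returns [x] only up to the idempotent at the tail of [a], which [T_sa] absorbs. *)
  by rewrite addr0 compvE h2 rdiv_Marr eqxx (TM hx (hat_tl a)) -mulrA T_sa.
rewrite Ev /comphat h2 h1 T0 add0r big1 => [|b _]; last by rewrite compwE h1 ldiv0 T0 mulr0.
rewrite addr0 big1 ?addr0 // => a' _; rewrite big1 // => b _.
by rewrite compxE -h2 rdiv_idemhatM ldiv_idemhatM ?hd_StarOut // T0 mulr0 mul0r.
Qed.

Lemma block_ext_sout x b : hat x -> block_ext (sout b * x) = sb b * T x.
Proof.
move=> hx; have h1 : ehat * (sout b * x) = 0 by rewrite mulrA ehat_sout mul0r.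
have h2 : sout b * x * ehat = sout b * x by rewrite -mulrA hx.2.
rewrite /block_ext compz_Mhat // scale0r add0r.
have Ew : \sum_b' sb b' * T (compw (sout b * x) b') = sb b * T x.
  rewrite (bigD1 b) //= big1 => [|b' b'b]; last first.
    by rewrite compwE h2 ldiv_arrM (inj_eq StarOut_inj) (negbTE b'b) T0 mulr0.
  by rewrite addr0 compwE h2 ldiv_arrM eqxx (TM (hat_hd b) hx) mulrA sb_T.
rewrite Ew /comphat h1 mul0r T0 add0r big1 ?add0r => [|a _]; last first.
  by rewrite compvE h1 rdiv0 T0 mul0r.
rewrite big1 ?addr0 // => a _; rewrite big1 // => b' _.
by rewrite compxE -h2 rdiv_Midemhat ?tl_StarIn // ldiv0 T0 mulr0 mul0r.
Qed.

Lemma block_ext_sout_sin x a b : hat x ->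
  block_ext (sout b * x * sin a) = sb b * T x * sa a.
Proof.
move=> hx; have h1 : ehat * (sout b * x * sin a) = 0.
  by rewrite !mulrA ehat_sout !mul0r.
have h2 : sout b * x * sin a * ehat = 0 by rewrite -mulrA [X in _ * X](sin_ehat a) mulr0.
rewrite /block_ext {1}/compz coef_Marr_nil scale0r add0r.
rewrite /comphat h1 mul0r T0 add0r big1 ?add0r => [|a' _]; last first.
  by rewrite compvE h1 rdiv0 T0 mul0r.
rewrite big1 ?add0r => [|b' _]; last by rewrite compwE h2 ldiv0 T0 mulr0.
rewrite (bigD1 a) //= [X in _ + X]big1 => [|a' a'a]; last first.
  rewrite big1 // => b' _; rewrite compxE rdiv_Marr (inj_eq StarIn_inj) (negbTE a'a).
  by rewrite ldiv0 T0 mulr0 mul0r.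
rewrite addr0 (bigD1 b) //= [X in _ + X]big1 => [|b' b'b]; last first.
  rewrite compxE rdiv_Marr eqxx -[sout b * x * _]mulrA ldiv_arrM (inj_eq StarOut_inj).
  by rewrite (negbTE b'b) T0 mulr0 mul0r.
rewrite addr0 compxE rdiv_Marr eqxx -[sout b * x * _]mulrA ldiv_arrM eqxx.
rewrite (TM (hat_hd b) (hatM hx (hat_tl a))) (TM hx (hat_tl a)) -!mulrA T_sa.
by rewrite [LHS]mulrA sb_T.
Qed.

Lemma block_ext_idem : block_ext ek = Pk.
Proof.
rewrite /block_ext {1}/compz coef_idem !eqxx scale1r.
rewrite /comphat idemhat_idem mul0r T0 addr0.
rewrite big1 ?addr0 => [|a _]; last by rewrite compvE idemhat_idem rdiv0 T0 mul0r.
rewrite big1 ?addr0 => [|b _]; last by rewrite compwE idem_idemhat ldiv0 T0 mulr0.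
rewrite big1 ?addr0 // => a _; rewrite big1 // => b _.
rewrite compxE (_ : ldiv _ _ = 0) ?T0 ?mulr0 ?mul0r //.
apply: path_coefP => i s; rewrite coef_ldiv coef_rdiv coef_idem path_coef0.
by rewrite andbF mulr0.
Qed.

Lemma block_ext_block l r x : hat x ->
  block_ext (lblock l * x * rblock r) = lval l * T x * rval r.
Proof.
move=> hx; case: l r => [b|] [a|] /=.
- exact: block_ext_sout_sin.
- by rewrite -mulrA hx.2 block_ext_sout // -mulrA -(TM hx hat_idemhat) hx.2.
- by rewrite hx.1 block_ext_sin // -(TM hat_idemhat hx) hx.1.
rewrite hx.1 hx.2 block_ext_hat // -(TM hat_idemhat hx) hx.1.
by rewrite -(TM hx hat_idemhat) hx.2.
Qed.

Lemma hat_rlblock r l : hat (rblock r * lblock l).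
Proof.
case: r l => [a|] [b|] /=; first exact: hat_sin_sout.
- by rewrite sin_ehat; apply: hat0.
- by rewrite ehat_sout; apply: hat0.
by rewrite idemhatM; apply: hat_idemhat.
Qed.

Lemma T_rlblock r l : T (rblock r * lblock l) = rval r * lval l.
Proof.
case: r l => [a|] [b|] /=; first exact: T_sin_sout.
- by rewrite sin_ehat T0 -sa_Pk -mulrA (Pk_T hat_idemhat) mulr0.
- by rewrite ehat_sout T0 -Pk_sb mulrA (T_Pk hat_idemhat) mul0r.
exact: TM hat_idemhat hat_idemhat.
Qed.

Lemma block_ext0 : block_ext 0 = 0.
Proof. by rewrite (block_ext_hat hat0) T0. Qed.

Lemma block_ext1 : block_ext 1 = 1.
Proof.
have -> : 1 = 1 *: ehat + ek by rewrite scale1r /idemhat subrK.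
by rewrite block_ext_linear scale1r (block_ext_hat hat_idemhat) block_ext_idem.
Qed.

Lemma block_extM u v : block_ext (u * v) = block_ext u * block_ext v.
Proof.
elim/block_ind: u => [c u1 u2 IH1 IH2||l x r hx].
- by rewrite mulrDl -cpa_scaleAl !block_ext_linear IH1 IH2 [RHS]mulrDl -endo_scaleAl.
- elim/block_ind: v => [c v1 v2 IH1 IH2||l x r hx].
  + by rewrite mulrDr -cpa_scaleAr !block_ext_linear IH1 IH2 [RHS]mulrDr -endo_scaleAr.
  + by rewrite idemM eqxx block_ext_idem PkPk.
  rewrite block_ext_block // block_ext_idem !mulrA; case: l => [b|] /=.
    have -> : ek * sout b = sout b by have := idem_arr K (StarOut b : Q1); rewrite hd_StarOut.
    by rewrite Pk_sb; apply: (block_ext_block (Some b)).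
  by rewrite idem_idemhat !mul0r (Pk_T hat_idemhat) !mul0r block_ext0.
elim/block_ind: v => [c v1 v2 IH1 IH2||l' x' r' hx'].
- by rewrite mulrDr -cpa_scaleAr !block_ext_linear IH1 IH2 [RHS]mulrDr -endo_scaleAr.
- rewrite block_ext_block // block_ext_idem -!mulrA; case: r => [a|] /=.
    have -> : sin a * ek = sin a by have := arr_idem K (StarIn a : Q1); rewrite tl_StarIn.
    by rewrite sa_Pk !mulrA; apply: (block_ext_block l (Some a)).
  by rewrite idemhat_idem !mulr0 (T_Pk hat_idemhat) !mulr0 block_ext0.
have hm := hat_rlblock r l'.
have -> : lblock l * x * rblock r * (lblock l' * x' * rblock r') =
  lblock l * (x * (rblock r * lblock l') * x') * rblock r' by rewrite !mulrA.
rewrite !block_ext_block //; last exact: hatM (hatM hx hm) hx'.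
by rewrite (TM (hatM hx hm) hx') (TM hx hm) T_rlblock !mulrA.
Qed.

Lemma block_ext_arr_in a : block_ext (sin a) = sa a.
Proof.
have E : idem (tl (val a)) * sin a = sin a := idem_arr K (StarIn a : Q1); rewrite -E.
by rewrite block_ext_sin ?T_sa //; apply: hat_tl.
Qed.

Lemma block_ext_arr_out b : block_ext (sout b) = sb b.
Proof.
have E : sout b * idem (hd (val b)) = sout b := arr_idem K (StarOut b : Q1); rewrite -E.
by rewrite block_ext_sout ?sb_T //; apply: hat_hd.
Qed.

Lemma block_ext_unique (F : cpa K Q1 -> endo N) : linear F ->
  (forall u v, F (u * v) = F u * F v) -> F ek = Pk ->
  (forall a, F (sin a) = sa a) -> (forall b, F (sout b) = sb b) ->
  (forall x, hat x -> F x = T x) -> F =1 block_ext.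
Proof.
move=> Fl FM Fek Fa Fb FT; elim/block_ind => [c u v IHu IHv||l x r hx].
- by rewrite Fl IHu IHv block_ext_linear.
- by rewrite Fek block_ext_idem.
have El : F (lblock l) = lval l.
  by case: l => [b|] /=; [exact: Fb|exact/FT/hat_idemhat].
have Er : F (rblock r) = rval r.
  by case: r => [a|] /=; [exact: Fa|exact/FT/hat_idemhat].
by rewrite block_ext_block // FM FM El Er (FT x hx).
Qed.

End Extension.
End Decomposition.

(** * The mutated representation *)

Section Action.
Variables (K : fieldType) (I : finType) (Q : quiver I) (S : cpa K Q).
Variable M : lmodType (jac S).
Implicit Types (u v : cpa K Q) (m : kmod M).

Lemma actM u v m : act (u * v) m = act u (act v m).
Proof.
have E : tojac S (u * v) = tojac S u * tojac S v := rmorphM (toqring (jacideal S)) u v.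
rewrite /act E; exact: esym (scalerA _ _ (m : M)).
Qed.

Lemma actD u v m : act (u + v) m = act u m + act v m.
Proof.
rewrite /act /tojac (raddfD (toqring (jacideal S))).
exact: (scalerDl (m : M)).
Qed.

Lemma act0 m : act 0 m = 0.
Proof. by apply: (@addrI _ (act 0 m)); rewrite -actD !addr0. Qed.

Lemma actN u m : act (- u) m = - act u m.
Proof. by apply: (@addrI _ (act u m)); rewrite -actD !subrr act0. Qed.

Lemma actZ c u m : act (c *: u) m = c *: act u m.
Proof.
rewrite -[c *: u](cpa_scale1Z c u) actM //.
Qed.

Lemma act_sum (J : finType) (F : J -> cpa K Q) m :
  act (\sum_j F j) m = \sum_j act (F j) m.
Proof. by apply: (big_morph (fun u => act u m)) => [u v|]; rewrite ?actD ?act0. Qed.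

(** A generator of the ideal serves as its own approximation in the adic closure. *)
Lemma act_cder a m : act (cder a S) m = 0.
Proof.
rewrite /act; have -> : tojac S (cder a S) = tojac S 0; last exact: act0.
apply/toqringP; rewrite subr0; apply/asboolP => n; exists (cder a S).
  exists [:: (1, cder a S, 1)]; last by rewrite big_seq1 mul1r mulr1.
  by move=> x; rewrite inE => /eqP -> /=; exists a.
by rewrite subrr; apply/idealpowE.
Qed.

Lemma iota_to_Mv j m : iota_Mv M j (to_Mv M j m) = act (idem j) m.
Proof. by []. Qed.

Lemma act_iota_Mv j (x : Mv M j) : act (idem j) (iota_Mv M j x) = iota_Mv M j x.
Proof.
case: x => m /= /impP[m' <-]; by rewrite -actM idemM eqxx.
Qed.

Lemma iota_to_Mhat k m : iota_Mhat M k (to_Mhat M k m) = act (idemhat K Q k) m.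
Proof. by []. Qed.

Lemma act_iota_Mhat k (x : Mhat M k) :
  act (idemhat K Q k) (iota_Mhat M k x) = iota_Mhat M k x.
Proof. by case: x => m /= /impP[m' <-]; rewrite -actM idemhatM. Qed.

Lemma Mhat_inj k (x y : Mhat M k) : iota_Mhat M k x = iota_Mhat M k y -> x = y.
Proof. exact: val_inj. Qed.

Lemma Mv_inj j (x y : Mv M j) : iota_Mv M j x = iota_Mv M j y -> x = y.
Proof. exact: val_inj. Qed.

Lemma to_Mhat_idem k m : to_Mhat M k (act (idem k) m) = 0.
Proof.
by apply: Mhat_inj; rewrite iota_to_Mhat -actM idemhat_idem act0 linear0.
Qed.

Hypotheses (Q_loop_free : loop_free Q) (S_potential : potential S).
Variable k : I.

(** On the summand at [b] the composite is the action of sum_a a d_(ba)(S) = d_b(S). *)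
Lemma alpha_gamma (x : Mout M k) : alpha M k (gamma M k x) = 0.
Proof.
apply: Mv_inj; rewrite linear0 /alpha iota_to_Mv.
rewrite (_ : \sum_a _ = 0) ?linear0 //.
transitivity (\sum_(a : inar Q k) \sum_(b : outar Q k)
    act (arr (val a) * cder2 (val b) (val a) S) (iota_Mv M _ (x b))).
  apply: eq_bigr => a _; rewrite /gamma iota_to_Mv linear_sum linear_sum.
  by apply: eq_bigr => b _; rewrite /= -!actM arr_idem.
rewrite exchange_big big1 // => b _ /=; rewrite -act_sum sum_arr_cder2 ?act_cder //.
exact: eqP (valP b).
Qed.

(** The component at [a] of the composite is the action of sum_b d_(ba)(S) b = d_a(S). *)
Lemma gamma_beta (y : Mv M k) : gamma M k (beta M k y) = 0.
Proof.
apply: functional_extensionality_dep => a; apply: Mv_inj.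
rewrite [(0 : Min M k) a]/0 linear0 /gamma iota_to_Mv.
rewrite (_ : \sum_b _ = 0) ?linear0 //.
transitivity (\sum_(b : outar Q k)
    act (cder2 (val b) (val a) S * arr (val b)) (iota_Mv M _ y)).
  apply: eq_bigr => b _; rewrite /beta iota_to_Mv -!actM.
  by rewrite cder2_idem.
by rewrite -act_sum sum_cder2_arr ?act_cder //; exact: eqP (valP a).
Qed.

Variable V : lmodType {ffun I -> K}.
Variable rho : {linear Mout M k -> kerg M k}.
Variable sigma : {linear kera_img M k -> kera M k}.

(** In A the summand im gamma yields - gamma at once. In B and C the maps [corestr] and [induced]
    are 0 by convention when ill-defined; [alpha_gamma], resp. [gamma_beta], excludes that
    default. *)
Lemma betabar_alphabar d (x : Mout M k) :
  betabar V sigma d (alphabar V rho d x) = - gamma M k x.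
Proof.
case: d => /=.
- rewrite /betabarA /alphabarA /= !linear0 addr0.
  exact: (linearN (iota_img M k) (gamma_img M k x)).
- have <- : iota_kera M k (gamma_kera M k x) = gamma M k x.
    rewrite /iota_kera /gamma_kera /= /corestr asboolT.
      by rewrite insubdK //; apply/eqP; exact: alpha_gamma.
    by move=> y; apply/eqP; exact: alpha_gamma.
  exact: (linearN (iota_kera M k) (gamma_kera M k x)).
have <- : gammabar M k (pi_cokerb M k x) = gamma M k x.
  rewrite /gammabar /= /induced asboolT.
    apply/eqP; rewrite -subr_eq0 -linearB.
    have /toquoP/impP[y <-] :
        toquo (im_beta M k) (quo_repr (pi_cokerb M k x)) = toquo (im_beta M k) x.
      by rewrite quo_reprK.
    by apply/eqP; exact: gamma_beta.
  by move=> w /impP[y <-]; exact: gamma_beta.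
rewrite /betabarC /alphabarC /= !linear0 addr0.
exact: (linearN (gammabar M k) (pi_cokerb M k x)).
Qed.

End Action.

(** * Verification of the relations for the mutated representation *)

Section EtaTilde.
Variables (K : fieldType) (I : finType) (Q : quiver I) (S : cpa K Q).
Variables (M : lmodType (jac S)) (V : lmodType {ffun I -> K}) (k : I).
Variable rho : {linear Mout M k -> kerg M k}.
Variable sigma : {linear kera_img M k -> kera M k}.
Variable d : description.
Hypotheses (Q_loop_free : loop_free Q) (S_potential : potential S).
Hypothesis k_cycle : not_in_two_cycle Q k.
Notation Q1 := (premut Q k).
Notation N := (Mbar M V k d).
Notation ehat := (idemhat K Q1 k).
Notation eta := (@Defs.eta K I Q S M V k rho sigma d).
Notation eta_path := (@eta_path K I Q S M V k rho sigma d).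
Notation eta_arrow := (@eta_arrow K I Q S M V k rho sigma d).
Notation Theta := (@Theta K I Q S M V k d).
Notation idembar := (@idembar K I Q S M V k d).
Notation sa a := (@starin K I Q S M V k sigma d a).
Notation sb b := (@starout K I Q S M V k rho d b).

Lemma ThetaE u (x : N) :
  Theta u x = (to_Mhat M k (act (psi_kappa S u) (iota_Mhat M k x.1)), 0).
Proof. by []. Qed.

Lemma Theta_linear : linear Theta.
Proof.
move=> c u v; apply: endoP => x; rewrite [RHS]/(c *: Theta u x + Theta v x) !ThetaE.
rewrite psi_kappaP // actD actZ !linearP; congr (_, _).
by rewrite /= scaler0 addr0.
Qed.

Lemma ThetaM u v : hat u -> hat v -> Theta (u * v) = Theta u * Theta v.
Proof.
move=> hu hv; apply: endoP => x; rewrite [RHS]/(Theta u (Theta v x)) !ThetaE /=.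
congr (_, _); congr (to_Mhat _ _ _).
rewrite iota_to_Mhat -!actM psi_kappaM ?hu.2 //.
(* Between the two actions stands the projection onto e_khat M; it is the identity there, since all
   paths in a value of psi have their head off k. *)
have E : idemhat K Q k * psi_kappa S v = psi_kappa S v := idemhat_psi S (kappa v).
by rewrite -{1}E mulrA.
Qed.

Lemma idembar_kE (x : N) : idembar k x = (0, x.2).
Proof. by rewrite /= /idembar_fun eqxx to_Mhat_idem. Qed.

Lemma Theta_idem j : j != k -> Theta (idem j) = idembar j.
Proof.
move=> jk; apply: endoP => x; rewrite ThetaE psi_kappa_idem //.
by rewrite /= /idembar_fun (negbTE jk).
Qed.

Lemma eta_pathelt c (p : qpath Q1) : eta (c *: pathelt K (val p)) = c *: eta_path p.
Proof.
rewrite /Defs.eta (@fsbig_seqT _ _ [:: p]) //=.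
  by rewrite big_seq1 cpaZ /pathelt eqxx mulr1.
move=> q; rewrite inE cpaZ /pathelt (inj_eq val_inj) => /negbTE ->.
by rewrite mulr0 scale0r.
Qed.

Lemma eta_idem_k c : eta (c *: idem k) = c *: idembar k.
Proof.
have := eta_pathelt c (@QPath _ Q1 (k, [::]) isT).
by rewrite /Defs.eta_path /= big_nil mulr1.
Qed.

Lemma arr_pathb (c : Q1) : pathb (hd c) [:: c]. Proof. by rewrite /= eqxx. Qed.

Lemma eta_arr (c : Q1) : eta (arr c) = idembar (hd c) * eta_arrow c.
Proof.
have := eta_pathelt 1 (@QPath _ Q1 (_, _) (arr_pathb c)).
by rewrite !scale1r => ->; rewrite /Defs.eta_path big_seq1.
Qed.

Lemma idembar_sa a : idembar (tl (val a)) * sa a = sa a.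
Proof.
apply: endoP => x; have ta := inar_tl Q_loop_free a.
rewrite -[LHS]/((to_Mhat M k (act (idem (tl (val a)))
    (iota_Mhat M k (to_Mhat M k (iota_Mv M _ (betabar V sigma d x.2 a))))),
  if tl (val a) == k then 0 else 0) : N).
by rewrite if_same iota_to_Mhat -actM idem_idemhat_neq // act_iota_Mv.
Qed.

Lemma idembar_sb b : idembar k * sb b = sb b.
Proof. by apply: endoP => x; exact: (idembar_kE (sb b x)). Qed.

Lemma eta_sin a : eta (arr (StarIn a : Q1)) = sa a.
Proof. by rewrite eta_arr /=; apply: idembar_sa. Qed.

Lemma eta_sout b : eta (arr (StarOut b : Q1)) = sb b.
Proof. by rewrite eta_arr hd_StarOut; apply: idembar_sb. Qed.

Lemma psi_kappa_idemhat : psi_kappa S ehat = idemhat K Q k.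
Proof.
have sumhat (Q' : quiver I) : idemhat K Q' k = \sum_(j | j != k) idem j.
  by rewrite /idemhat -sum_idem (bigD1 k) //= addrAC subrr add0r.
have pkD : {morph @psi_kappa K I Q k S : u v / u + v}.
  by move=> u v; have := psi_kappaP S_potential k_cycle 1 u v; rewrite !scale1r.
have pk0 : psi_kappa S (0 : cpa K Q1) = 0.
  by apply: (@addrI _ (psi_kappa S (0 : cpa K Q1))); rewrite -pkD !addr0.
rewrite sumhat (big_morph _ pkD pk0) sumhat; apply: eq_bigr => j jk.
exact: psi_kappa_idem.
Qed.

Lemma Theta1 : Theta ehat + idembar k = 1.
Proof.
apply: endoP => x; rewrite [LHS]/(Theta ehat x + idembar k x) idembar_kE ThetaE.
rewrite psi_kappa_idemhat act_iota_Mhat; case: x => x y.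
rewrite -[LHS]/((to_Mhat M k (iota_Mhat M k x) + 0, 0 + y) : N) addr0 add0r.
have -> : to_Mhat M k (iota_Mhat M k x) = x.
  by apply: Mhat_inj; rewrite iota_to_Mhat act_iota_Mhat.
by [].
Qed.

Lemma sa_idembar a : sa a * idembar k = sa a.
Proof. by apply: endoP => x; exact: (congr1 (sa a) (idembar_kE x)). Qed.

Lemma idembar_kk : idembar k * idembar k = idembar k.
Proof.
apply: endoP => x; apply: etrans (idembar_kE (idembar k x)) _.
exact: etrans (congr1 (fun y : N => (0, y.2) : N) (idembar_kE x)) (esym (idembar_kE x)).
Qed.

Lemma Theta_sa a : Theta (idem (tl (val a))) * sa a = sa a.
Proof. by rewrite Theta_idem ?idembar_sa //; apply: inar_tl. Qed.

Lemma injout_idem b m :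
  @injout K I Q S M k b (act (idem (hd (val b))) m) = injout b m.
Proof.
apply: functional_extensionality_dep => b'; rewrite /injout; case: eqP => // ->.
by apply: Mv_inj; rewrite !iota_to_Mv -actM idemM eqxx.
Qed.

Lemma sb_Theta b : sb b * Theta (idem (hd (val b))) = sb b.
Proof.
have hb := outar_hd Q_loop_free b.
rewrite Theta_idem //; apply: endoP => x.
rewrite -[LHS]/((0, alphabar V rho d (injout b (iota_Mhat M k (to_Mhat M k
  (act (idem (hd (val b))) (iota_Mhat M k x.1)))))) : N).
by rewrite iota_to_Mhat -actM idemhat_idem_neq // injout_idem.
Qed.

(** The idempotents introduced by projecting and including are absorbed by the two ends of the
    derivative. *)
Lemma gamma_injout a b m : iota_Mv M _ (gamma M k (injout b m) a) =
  act (cder2 (val b) (val a) S) m.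
Proof.
rewrite /gamma iota_to_Mv linear_sum (bigD1 b) //= [X in _ + X]big1 ?addr0 => [|b' b'b].
  by rewrite /injout eqxx iota_to_Mv -!actM idem_cder2 // cder2_idem.
by rewrite /injout (negbTE b'b) !linear0.
Qed.

Lemma Theta_sin_sout a b :
  Theta (arr (StarIn a : Q1) * arr (StarOut b : Q1)) = sa a * sb b.
Proof.
apply: endoP => x; rewrite [RHS]/(sa a (sb b x)) ThetaE psi_kappa_star //.
rewrite [RHS]/= /starin_fun /=; congr (_, _); congr (to_Mhat _ _ _).
rewrite (betabar_alphabar Q_loop_free S_potential).
by rewrite actN -gamma_injout -linearN.
Qed.

Notation et := (eta_tilde V rho sigma d).

Lemma eta_tildeE u : et u = block_ext Theta (idembar k) (fun a => sa a) (fun b => sb b) u.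
Proof.
rewrite /eta_tilde /block_ext.
apply: (f_equal2 +%R); [apply: (f_equal2 +%R); [apply: (f_equal2 +%R);
  [apply: (f_equal2 +%R)|]|]|].
- exact: eta_idem_k.
- by [].
- by apply: eq_bigr => a _; rewrite eta_sin.
- by apply: eq_bigr => b _; rewrite eta_sout.
apply: eq_bigr => a _; apply: eq_bigr => b _.
exact: (f_equal2 *%R (f_equal2 *%R (eta_sout b) erefl) (eta_sin a)).
Qed.

Lemma eta_tilde_linear : linear et.
Proof. by move=> c u v; rewrite !eta_tildeE; apply/block_ext_linear/Theta_linear. Qed.

Lemma eta_tildeM u v : et (u * v) = et u * et v.
Proof.
rewrite !eta_tildeE; apply: block_extM => //.
- exact: Theta_linear.
- exact: ThetaM.
- exact: Theta_sin_sout.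
- exact: Theta_sa.
- exact: sb_Theta.
- exact: idembar_kk.
- exact: Theta1.
- exact: sa_idembar.
exact: idembar_sb.
Qed.

Lemma eta_tilde1 : et 1 = 1.
Proof.
rewrite eta_tildeE; apply: block_ext1 => //; [exact: Theta_linear|exact: Theta1].
Qed.

Lemma eta_tilde_hat x : hat x -> et x = Theta x.
Proof. by move=> hx; rewrite eta_tildeE block_ext_hat //; exact: Theta_linear. Qed.

Lemma eta_tilde_idem j : et (idem j) = idembar j.
Proof.
have [->|jk] := eqVneq j k.
  by rewrite eta_tildeE block_ext_idem //; exact: Theta_linear.
by rewrite eta_tilde_hat ?Theta_idem //; exact: hat_idem.
Qed.

(** Away from k this is the agreement of psi kappa with [eta] on generators: [c] goes to [c] and
    [[ba]] to [ba]. *)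
Lemma eta_tilde_arr c : et (arr c) = eta_arrow c.
Proof.
have theta_arr (w : cpa K Q) : hat (arr c : cpa K Q1) -> psi_kappa S (arr c : cpa K Q1) = w ->
    et (arr c) = theta V d (rhotilde M k w).
  by move=> hc <-; exact: eta_tilde_hat.
case: c theta_arr => [z|b a|a|b] theta_arr.
- apply: theta_arr; last exact: psi_kappa_plain.
  have /andP[h t] := valP z; split.
    by rewrite -(idem_arr K (Plain z : Q1)) mulrA idemhat_idem_neq.
  by rewrite -(arr_idem K (Plain z : Q1)) -mulrA idem_idemhat_neq.
- apply: theta_arr; last exact: psi_kappa_comp.
  split.
    by rewrite -(idem_arr K (Comp b a : Q1)) mulrA idemhat_idem_neq ?(outar_hd Q_loop_free).
  by rewrite -(arr_idem K (Comp b a : Q1)) -mulrA idem_idemhat_neq ?(inar_tl Q_loop_free).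
- rewrite eta_tildeE; apply: block_ext_arr_in => //.
  + exact: Theta_linear.
  + exact: ThetaM.
  exact: Theta_sa.
rewrite eta_tildeE; apply: block_ext_arr_out => //.
- exact: Theta_linear.
- exact: ThetaM.
exact: sb_Theta.
Qed.

Lemma eta_tilde_path p : et (pathelt K (val p)) = eta_path p.
Proof.
have -> : val p = (ph p, ps p) by rewrite /ph /ps; case: (val p).
rewrite /Defs.eta_path; move: (qpathP p); move: (ph p) (ps p) => i s.
rewrite -eta_tilde_idem; elim: s i => [|c s IH] i h.
  by rewrite big_nil mulr1.
rewrite pathelt_cons // eta_tildeM eta_tilde_arr big_cons.
case/andP: h => /eqP <- h; rewrite IH // !mulrA; congr (_ * _).
(* The idempotents at both ends of [c] fix [eta_arrow c], so the one at the tail, left by the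
   induction, can be exchanged for the one at the head. *)
have El := eta_tildeM (arr c) (idem (tl c)).
have Er := eta_tildeM (idem (hd c)) (arr c).
rewrite arr_idem eta_tilde_arr in El.
rewrite idem_arr eta_tilde_arr in Er.
exact: etrans (esym El) Er.
Qed.

(** Finite support makes [eta u] a genuine finite sum, and both sides are compared path by path. *)
Lemma eta_tilde_path_algebra u : in_path_algebra u -> et u = eta u.
Proof.
move=> /finite_seqP[r rE]; set s := undup r.
have sP p : p \notin s -> u p = 0.
  rewrite mem_undup => pr; apply/eqP/negPn/negP => up; move/negP: pr; apply.
  by have : [set` r]%classic p by rewrite -rE.
have uE : u = \sum_(p <- s) u p *: pathelt K (val p).
  apply: cpaE => q; rewrite cpa_sum; case/boolP: (q \in s) => qs; last first.
    rewrite sP // big_seq big1 // => p ps; rewrite cpaZ /pathelt (inj_eq val_inj).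
    by case: eqP => [E|]; rewrite ?mulr0 //; move: qs; rewrite E ps.
  rewrite (bigD1_seq q) ?undup_uniq //= cpaZ /pathelt eqxx mulr1 big1 ?addr0 //.
  by move=> p pq; rewrite cpaZ (inj_eq val_inj) eq_sym (negbTE pq) mulr0.
have etD : {morph et : u v / u + v}.
  by move=> v w; rewrite -[v]scale1r eta_tilde_linear !scale1r.
have et0 : et 0 = 0.
  by apply: (@addrI _ (et 0)); rewrite -etD !addr0.
have etZ c v : et (c *: v) = c *: et v.
  by rewrite -[c *: v]addr0 eta_tilde_linear et0 addr0.
rewrite {1}uE (big_morph _ etD et0) /Defs.eta (@fsbig_seqT _ _ s) ?undup_uniq //.
  by apply: eq_bigr => p _; rewrite etZ eta_tilde_path.
by move=> p /sP ->; rewrite scale0r.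
Qed.

Lemma eta_tilde_vring_hom : vring_hom et.
Proof.
split; first exact: eta_tilde_linear.
  by split; [exact: eta_tilde1|exact: eta_tildeM].
exact: eta_tilde_idem.
Qed.

Lemma eta_tilde_extends : extends_eta_Theta rho sigma et.
Proof.
split; first exact: eta_tilde_path_algebra.
by move=> u; apply/eta_tilde_hat/hat_comphat.
Qed.

Lemma in_path_algebra_pathelt (p : qpath Q1) : in_path_algebra (pathelt K (val p) : cpa K Q1).
Proof.
apply: (@sub_finite_set _ _ [set` [:: p]]%classic); last exact: finite_seq.
move=> q /=; rewrite /pathelt inE (inj_eq val_inj).
by case: (q == p) => //; rewrite mulr0n eqxx.
Qed.

Lemma eta_tilde_unique F : vring_hom F -> extends_eta_Theta rho sigma F -> F =1 et.
Proof.
move=> [Fl [F1 FM] Fi] [Fe FT] u; rewrite eta_tildeE.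
have Farr (c : Q1) : F (arr c) = eta (arr c).
  by apply: Fe; apply: (in_path_algebra_pathelt (@QPath _ Q1 (_, _) (arr_pathb c))).
apply: block_ext_unique => //.
- exact: Theta_linear.
- exact: ThetaM.
- exact: Theta_sa.
- exact: sb_Theta.
- by move=> a; rewrite Farr eta_sin.
- by move=> b; rewrite Farr eta_sout.
by move=> x [h1 h2]; rewrite -h2 -h1 FT.
Qed.

End EtaTilde.

(** * Nilpotency of the mutated representation *)

Section Nilpotency.
Variables (K : fieldType) (I : finType) (Q : quiver I) (S : cpa K Q).
Variables (M : lmodType (jac S)) (V : lmodType {ffun I -> K}) (k : I).
Variable rho : {linear Mout M k -> kerg M k}.
Variable sigma : {linear kera_img M k -> kera M k}.
Variable d : description.
Hypotheses (Q_loop_free : loop_free Q) (S_potential : potential S).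
Hypothesis k_cycle : not_in_two_cycle Q k.
Notation Q1 := (premut Q k).
Notation N := (Mbar M V k d).
Notation sa a := (@starin K I Q S M V k sigma d a).
Notation et := (eta_tilde V rho sigma d).

Definition annihilated (n : nat) (m : kmod M) := forall w, order_ge n w -> act w m = 0.

Lemma annihilated_leq m n x : (m <= n)%N -> annihilated m x -> annihilated n x.
Proof. by move=> mn hx w /(order_ge_leq mn) /hx. Qed.

Lemma endo_sumE (W : lmodType K) (J : finType) (F : J -> endo W) (x : W) :
  (\sum_j F j) x = \sum_j F j x.
Proof. exact: (big_morph (fun f : endo W => f x)). Qed.

Lemma endo_mulE (W : lmodType K) (f g : endo W) (x : W) : (f * g) x = f (g x).
Proof. by []. Qed.

Lemma Theta_annihilated n (u : cpa K Q1) (x : N) :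
  annihilated n (iota_Mhat M k x.1) -> order_ge n.*2 u -> Theta M V d u x = 0.
Proof.
move=> hx hu; rewrite ThetaE hx ?linear0 //.
by rewrite -[n]doubleK; apply: psi_kappa_order.
Qed.

(* psi o kappa at worst halves the order, and extracting a component of u costs
   at most two starred arrows. *)
Lemma eta_tilde_annihilated n (u : cpa K Q1) (x : N) :
  annihilated n (iota_Mhat M k x.1) ->
  (forall a, annihilated n (iota_Mhat M k (sa a x).1)) ->
  order_ge n.*2.+2 u -> et u x = 0.
Proof.
move=> hx ha hu; rewrite eta_tildeE // /block_ext.
have z0 : compz u = 0 by rewrite /compz; move/order_ge_coef: hu => ->.
have hatu (v w : cpa K Q1) m : order_ge m v -> order_ge m (v * w) /\ order_ge m (w * v).
  by move=> hv; split; [rewrite -[m]addn0|rewrite -[m]add0n]; apply: order_geM.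
have s0 : Theta M V d (comphat u) x = 0.
  apply: (Theta_annihilated hx); apply: (hatu _ _ _ _).1; apply: (hatu _ _ _ _).2.
  by apply: order_ge_leq hu; rewrite leqW.
have sv a : (Theta M V d (compv u a) * sa a) x = 0.
  apply: (Theta_annihilated (x := sa a x)); first exact: ha.
  rewrite compvE; apply: rdiv_order; apply: (hatu _ _ _ _).2.
  exact: order_ge_leq hu.
have sw b : (starout V rho d b * Theta M V d (compw u b)) x = 0.
  rewrite endo_mulE (Theta_annihilated hx) ?linear0 //.
  rewrite compwE; apply: ldiv_order; apply: (hatu _ _ _ _).1.
  exact: order_ge_leq hu.
have sx a b : (starout V rho d b * Theta M V d (compx u a b) * sa a) x = 0.
  rewrite !endo_mulE (Theta_annihilated (ha a)) ?linear0 //.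
  by rewrite compxE; apply: ldiv_order; apply: rdiv_order.
rewrite z0 scale0r add0r.
transitivity (Theta M V d (comphat u) x
    + (\sum_a Theta M V d (compv u a) * sa a) x
    + (\sum_b starout V rho d b * Theta M V d (compw u b)) x
    + (\sum_a \sum_b starout V rho d b * Theta M V d (compx u a b) * sa a) x).
  by [].
have Sv : (\sum_a Theta M V d (compv u a) * sa a) x = 0.
  by rewrite endo_sumE big1 // => a _; apply: sv.
have Sw : (\sum_b starout V rho d b * Theta M V d (compw u b)) x = 0.
  by rewrite endo_sumE big1 // => b _; apply: sw.
have Sx : (\sum_a \sum_b starout V rho d b * Theta M V d (compx u a b) * sa a) x = 0.
  by rewrite endo_sumE big1 // => a _; rewrite endo_sumE big1 // => b _; apply: sx.
by rewrite s0 Sv Sw Sx !addr0.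
Qed.

(** Only finitely many vectors of [M] matter: the part of [x] away from k and its images under the
    [a^*]. The maximum of their exponents serves for all. *)
Lemma eta_tilde_locally_nilpotent : locally_nilpotent (@act K I Q S M) ->
  locally_nilpotent (fun u (x : N) => et u x).
Proof.
move=> Mnil x; have annE (m : kmod M) : exists n, annihilated n m.
  by have [n nP] := Mnil m; exists n => w /idealpowE /nP.
have [n0 h0] := annE (iota_Mhat M k x.1).
have [f fP] := choice (fun a => annE (iota_Mhat M k (sa a x).1)).
pose n := maxn n0 (\max_a f a); exists n.*2.+2 => u /idealpowE hu.
apply: (eta_tilde_annihilated (n := n)) => // [|a].
  by apply: annihilated_leq h0; apply: leq_maxl.
apply: annihilated_leq (fP a); apply: leq_trans (leq_maxr _ _).
exact: (leq_bigmax a).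
Qed.

Lemma eta_tilde_nilpotent : nilpotent (@act K I Q S M) ->
  nilpotent (fun u (x : N) => et u x).
Proof.
move=> [n nP]; have ann (m : kmod M) : annihilated n m by move=> w /idealpowE /nP.
exists n.*2.+2 => u /idealpowE hu x.
by apply: (eta_tilde_annihilated (n := n)) => // *; apply: ann.
Qed.

End Nilpotency.

(** * Finite dimension *)

Section FiniteDimension.
Variable K : fieldType.

Lemma findim_bij n (W : lmodType K) (g : {linear 'rV[K]_n -> W}) :
  injective g -> (forall w, exists v, g v = w) -> findim W.
Proof.
move=> g_inj g_surj; have [f fK] := choice g_surj.
exists n; constructor; exists f.
  by move=> c x y; apply: g_inj; rewrite fK linearP !fK.
by exists g => [w|v]; [exact: fK|apply: g_inj; rewrite fK].
Qed.

Lemma findimP (W : lmodType K) :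
  findim W <-> exists n (g : {linear 'rV[K]_n -> W}), injective g /\ forall w, exists v, g v = w.
Proof.
split=> [[n [[f f_lin [g fK gK]]]]|[n [g [? ?]]]]; last exact: (findim_bij (g := g)).
have g_lin : linear g.
  by move=> c x y; apply: (can_inj fK); rewrite gK f_lin !gK.
pose L := GRing.isLinear.Build K 'rV[K]_n W *:%R g g_lin.
pose g' : {linear 'rV[K]_n -> W} := HB.pack g L.
exists n, g'; split; first exact: (can_inj gK).
by move=> w; exists (f w); apply: fK.
Qed.

(** Among the matrices with rows in [P] one of maximal rank is chosen; a vector of [P] outside its
    row space could be adjoined and would raise the rank. *)
Lemma row_span (n : nat) (P : 'rV[K]_n -> Prop) :
  (forall c u v, P u -> P v -> P (c *: u + v)) -> P 0 ->
  exists A : 'M[K]_n, forall v, P v <-> (v <= A)%MS.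
Proof.
move=> PL P0.
have span m (A : 'M[K]_(m, n)) : (forall i, P (row i A)) -> forall v, (v <= A)%MS -> P v.
  move=> PA v /submxP[D ->]; rewrite mulmx_sum_row.
  by elim/big_ind: _ => // [x y Px Py|i _]; [rewrite -[x]scale1r; exact: PL|
    rewrite -[_ *: _]addr0; exact: PL].
pose X r := `[< exists A : 'M[K]_n, (forall i, P (row i A)) /\ \rank A = r >].
have X0 : exists r, X r.
  exists 0; apply/asboolP; exists 0; split; last by rewrite mxrank0.
  by move=> i; rewrite row0.
have Xn r : X r -> (r <= n)%N by move=> /asboolP[A [_ <-]]; exact: rank_leq_col.
case: (ex_maxnP X0 Xn) => r /asboolP[A [PA rA]] rmax.
exists A => v; split=> [Pv|]; last exact: span.
have sub : (A <= A + v)%MS by exact: addsmxSl.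
have PB i : P (row i (A + v)%MS).
  have : (row i (A + v)%MS <= A + v)%MS by exact: row_sub.
  case/sub_addsmxP=> -[D1 D2] ->; rewrite -[D1 *m A]scale1r; apply: PL.
    by apply: (span _ A PA); apply: submxMl.
  apply: (span _ v) => [j|]; last exact: submxMl.
  by have -> : row j v = v by apply/rowP => l; rewrite !mxE (ord1 j).
have : (\rank (A + v)%MS <= \rank A)%N.
  by rewrite rA; apply: rmax; apply/asboolP; exists (A + v)%MS.
rewrite (geq_leqif (mxrank_leqif_sup sub)) => h; exact: submx_trans (addsmxSr _ _) h.
Qed.

(** In coordinates of [W] the image of [f] is the row space of a matrix, and a row basis of it
    provides coordinates on [U]. *)
Lemma findim_inj (U W : lmodType K) (f : {linear U -> W}) :
  injective f -> findim W -> findim U.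
Proof.
move=> f_inj /findimP[n [g [g_inj g_surj]]].
have [||A AP] := @row_span n (fun v => exists u, g v = f u).
- by move=> c u v [x xE] [y yE]; exists (c *: x + y); rewrite !linearP xE yE.
- by exists 0; rewrite !linear0.
have rowP' (v : 'rV_(\rank A)) : exists u, f u = g (v *m row_base A).
  have vA : (v *m row_base A <= A)%MS by rewrite -(eq_row_base A) submxMl.
  have [_ /(_ vA)] := AP (v *m row_base A); by case=> u uE; exists u.
have [h hE] := choice rowP'.
have h_lin : linear h.
  by move=> c x y; apply: f_inj; rewrite linearP !hE mulmxDl -scalemxAl linearP.
pose L := GRing.isLinear.Build K 'rV[K]_(\rank A) U *:%R h h_lin.
apply: (findim_bij (g := HB.pack h L)) => [x y /(congr1 f)|u].
  rewrite /= !hE => /g_inj; apply: row_free_inj; exact: row_base_free.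
have [v vE] := g_surj (f u).
have vA : (v <= row_base A)%MS by rewrite eq_row_base; apply/AP; exists u.
have [D vD] := submxP vA.
by exists D; apply: f_inj; rewrite /= hE -vD.
Qed.

(** In coordinates of [W] the kernel of [f] is the row space of some [A]; the complement [A^C] meets
    it in 0 and spans the rest, so [f] maps it isomorphically onto [U]. *)
Lemma findim_surj (U W : lmodType K) (f : {linear W -> U}) :
  (forall u, exists w, f w = u) -> findim W -> findim U.
Proof.
move=> f_surj /findimP[n [g [g_inj g_surj]]].
have [||A AP] := @row_span n (fun v => f (g v) = 0).
- by move=> c u v uE vE; rewrite !linearP uE vE scaler0 addr0.
- by rewrite !linear0.
pose B := row_base (A^C)%MS.
have h_lin : linear (fun v : 'rV_(\rank (A^C)%MS) => f (g (v *m B))).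
  by move=> c x y; rewrite mulmxDl -scalemxAl !linearP.
pose L := GRing.isLinear.Build K 'rV[K]_(\rank (A^C)%MS) U *:%R _ h_lin.
pose h : {linear 'rV[K]_(\rank (A^C)%MS) -> U} :=
  HB.pack (fun v : 'rV_(\rank (A^C)%MS) => f (g (v *m B))) L.
apply: (findim_bij (g := h)) => [x y /= E|u].
  have xyA : ((x - y) *m B <= A)%MS.
    by apply/AP; rewrite mulmxBl !linearB; apply/eqP; rewrite subr_eq0 E.
  have xyC : ((x - y) *m B <= A^C)%MS by rewrite -(eq_row_base (A^C)%MS) submxMl.
  have : ((x - y) *m B <= A :&: A^C)%MS by rewrite sub_capmx xyA.
  rewrite capmx_compl submx0 => /eqP xy0.
  apply/eqP; rewrite -subr_eq0; apply/eqP.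
  apply: (row_free_inj (row_base_free (A^C)%MS)).
  by rewrite -/B xy0 mul0mx.
have [w <-] := f_surj u; have [v <-] := g_surj w.
have : (v <= A + A^C)%MS by apply/submx_full/addsmx_compl_full.
case/sub_addsmxP=> -[D1 D2] /= vE.
have : (D2 *m (A^C)%MS <= B)%MS by rewrite /B eq_row_base submxMl.
case/submxP=> D DE; exists D; rewrite /= -DE vE.
have : (D1 *m A <= A)%MS by exact: submxMl.
by move/AP => E; rewrite !linearD E add0r.
Qed.

Lemma findim_prod (U W : lmodType K) : findim U -> findim W -> findim (U * W)%type.
Proof.
move=> /findimP[m [f [f_inj f_surj]]] /findimP[n [g [g_inj g_surj]]].
pose h (v : 'rV[K]_(m + n)) : (U * W)%type := (f (lsubmx v), g (rsubmx v)).
have h_lin : linear h by move=> c x y; rewrite /h !linearP.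
pose L := GRing.isLinear.Build K 'rV[K]_(m + n) (U * W)%type *:%R h h_lin.
apply: (findim_bij (g := HB.pack h L)) => [x y /= [/f_inj xy1 /g_inj xy2]|[u w]].
  by rewrite -[x]hsubmxK xy1 xy2 hsubmxK.
have [x xE] := f_surj u; have [y yE] := g_surj w.
by exists (row_mx x y); rewrite /= /h row_mxKl row_mxKr xE yE.
Qed.

Lemma findim_subsp (U : lmodType K) (W : submodClosed U) : findim U -> findim (subsp W).
Proof. by apply: (findim_inj (f := @subsp_val K U W)); exact: val_inj. Qed.

Lemma findim_quo (U : lmodType K) (W : submodClosed U) : findim U -> findim (quo W).
Proof.
by apply: (findim_surj (f := @toquo K U W)) => x; exists (quo_repr x); rewrite /= quo_reprK.
Qed.

Lemma findim0 : findim ('rV[K]_0 : lmodType K).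
Proof. by apply: (findim_bij (g := idfun)) => // w; exists w. Qed.

Lemma findim_dsum (J : finType) (W : J -> lmodType K) :
  (forall j, findim (W j)) -> findim (dsum W).
Proof.
move=> hW.
(* The induction runs over lists of indices and asks for a linear map to a finite-dimensional space
   that separates the coordinates in [s]; this avoids splitting the dependent product itself. *)
suff restr_findim (s : seq J) : exists (U : lmodType K) (f : {linear dsum W -> U}),
    findim U /\ forall x y : dsum W, f x = f y -> {in s, forall j, x j = y j}.
  have [U [f [fU f_inj]]] := restr_findim (enum J).
  apply: (findim_inj (f := f)) fU => x y /f_inj xy.
  by apply: functional_extensionality_dep => j; apply: xy; rewrite mem_enum.
elim: s => [|j s [U [f [fU f_inj]]]].
  exists 'rV[K]_0, \0; split; first exact: findim0.
  by [].
have p_lin : linear (fun x : dsum W => x j) by [].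
pose L := GRing.isLinear.Build K (dsum W) (W j) *:%R _ p_lin.
pose p : {linear dsum W -> W j} := HB.pack (fun x : dsum W => x j) L.
exists (U * W j)%type, (lpair f p); split; first exact: findim_prod.
by move=> x y [/f_inj xy xyj] i; rewrite inE => /predU1P[->//|/xy].
Qed.
End FiniteDimension.

Section MutationFiniteDimension.
Variables (K : fieldType) (I : finType) (Q : quiver I) (S : cpa K Q).
Variables (M : lmodType (jac S)) (V : lmodType {ffun I -> K}) (k : I).
Hypotheses (fM : findim (kmod M)) (fV : findim (kvmod V)).

Lemma findim_Mbar d : findim (Mbar M V k d).
Proof.
have fMin : findim (Min M k) by apply: findim_dsum => a; apply: findim_subsp.
have fMout : findim (Mout M k) by apply: findim_dsum => b; apply: findim_subsp.
have fVk : findim (Vv V k) by apply: findim_subsp.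
have fkerg : findim (kerg_imb M k) by apply/findim_quo/findim_subsp.
have fkera : findim (kera M k) by apply: findim_subsp.
have fkera_img : findim (kera_img M k) by apply: findim_quo.
apply: findim_prod; first exact: findim_subsp.
case: d => /=; do ?[exact: fVk | apply: findim_prod] => //.
  exact: findim_subsp.
exact: findim_quo.
Qed.

Lemma findim_Vbar : findim (Vbar M V k).
Proof.
apply: findim_prod; first exact: findim_subsp.
by apply/findim_quo/findim_subsp/findim_subsp.
Qed.
End MutationFiniteDimension.

Theorem proposition6p7 (K : fieldType) (I : finType) (Q : quiver I)
    (S : cpa K Q) (M : lmodType (jac S)) (V : lmodType {ffun I -> K}) (k : I)
    (rho : {linear Mout M k -> kerg M k})
    (sigma : {linear kera_img M k -> kera M k}) (d : description) :
  loop_free Q -> potential S -> not_in_two_cycle Q k ->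
  is_retraction rho -> is_section sigma ->
  let et := eta_tilde V rho sigma d in
  [/\ vring_hom et,
      extends_eta_Theta rho sigma et /\
      (forall F, vring_hom F -> extends_eta_Theta rho sigma F -> F =1 et) &
      [/\ locally_nilpotent (@act K I Q S M) ->
            locally_nilpotent (fun u (x : Mbar M V k d) => et u x),
          nilpotent (@act K I Q S M) ->
            nilpotent (fun u (x : Mbar M V k d) => et u x) &
          findim (kmod M) /\ findim (kvmod V) ->
            findim (Mbar M V k d) /\ findim (Vbar M V k)]].
Proof.
move=> Q_loop_free S_potential k_cycle _ _ et; split.
- exact: eta_tilde_vring_hom.
- split; first exact: eta_tilde_extends.
  exact: eta_tilde_unique.
split; first exact: eta_tilde_locally_nilpotent.
  exact: eta_tilde_nilpotent.
by case=> fM fV; split; [exact: findim_Mbar|exact: findim_Vbar].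
Qed.
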